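(* Let $\sigma>1$, and for $\tau>0$ let $M_p^{\tau,\sigma}=p^{\tau p^\sigma}$ for $p\in\mathbb N$, $M_0^{\tau,\sigma}=1$, and let $\mathcal M_\sigma=\{(M_p^{\tau,\sigma})_{p\in\mathbb N_0}:\tau>0\}$. Then, both in the Roumieu case ($[\mathcal M_\sigma]=\{\mathcal M_\sigma\}$) and in the Beurling case ($[\mathcal M_\sigma]=(\mathcal M_\sigma)$), the Fourier transform $\mathcal F$ satisfies $$\mathcal F\big(\mathcal S_{[\mathcal M_\sigma]}^{[\mathcal M_\sigma]}(\mathbb R^n)\big)=\mathcal S_{[\mathcal M_\sigma]}^{[\mathcal M_\sigma]}(\mathbb R^n).$$
   Context: For $\varphi\in C^\infty(\mathbb R^n)$ and multi-indices $\alpha,\beta\in\mathbb N_0^n$: - $\varphi\in\mathcal S_{\{\mathcal M_\sigma\}}^{\{\mathcal M_\sigma\}}(\mathbb R^n)$ iff $(\exists\tau>0)(\exists C>0)(\forall\alpha,\beta)\ \sup_{x\in\mathbb R^n}|x^\alpha\partial^\beta\varphi(x)|\le C M^{\tau,\sigma}_{|\alpha|}M^{\tau,\sigma}_{|\beta|}$. - $\varphi\in\mathcal S_{(\mathcal M_\sigma)}^{(\mathcal M_\sigma)}(\mathbb R^n)$ iff $(\forall\tau>0)(\exists C>0)(\forall\alpha,\beta)\ \sup_{x\in\mathbb R^n}|x^\alpha\partial^\beta\varphi(x)|\le C M^{\tau,\sigma}_{|\alpha|}M^{\tau,\sigma}_{|\beta|}$. The Fourier transform is $(\mathcal Ff)(\xi)=\hat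 f(\xi)=\int_{\mathbb R^n}f(x)e^{-2\pi i x\xi}\,dx$, $\xi\in\mathbb R^n$, where $x\xi$ is the Euclidean inner product. *)

(* Defs.v *)
From HB Require Import structures.
From mathcomp Require Import all_boot all_order all_algebra.
From mathcomp Require Import complex.
From mathcomp Require Import all_classical all_reals all_analysis.

Set Implicit Arguments.
Unset Strict Implicit.
Unset Printing Implicit Defensive.

Import Order.TTheory GRing.Theory Num.Theory.
Import numFieldNormedType.Exports.

Local Open Scope classical_set_scope.
Local Open Scope ring_scope.

Section lebesgue_measure_tuple.
Context (R : realType).
Local Open Scope ereal_scope.
Local Notation mR := (measurableTypeR R).

Definition cons_tuple_pair n (p : mR * n.-tuple mR) : n.+1.-tuple mR :=
  [tuple of p.1 :: p.2].

Lemma measurable_cons_tuple_pair n :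
  measurable_fun [set: mR * n.-tuple mR] (@cons_tuple_pair n).
Proof. exact: measurable_cons. Qed.

Lemma measurable_tuple_box n (A : 'I_n -> set mR) :
  (forall i, measurable (A i)) ->
  measurable [set t : n.-tuple mR | forall i, A i (tnth t i)].
Proof.
move=> mA.
have -> : [set t : n.-tuple mR | forall i, A i (tnth t i)] =
          \bigcap_(i in [set: 'I_n]) ((fun t => tnth t i) @^-1` A i).
  by apply/seteqP; split=> [t At i _|t At i]; [exact: At|exact: (At i)].
apply: fin_bigcap_measurable => // i _.
by rewrite -[X in measurable X]setTI; apply: measurable_tnth.
Qed.

Let box_cons n (A : 'I_n.+1 -> set mR) :
  @cons_tuple_pair n @^-1` [set t | forall i, A i (tnth t i)] =
  A ord0 `*` [set t | forall i, A (lift ord0 i) (tnth t i)].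
Proof.
apply/seteqP; split=> [[x t] /= At|[x t] [/= Ax At] i].
  split=> [|i]; first exact: (At ord0).
  by have := At (lift ord0 i); rewrite tnthS.
case: (unliftP ord0 i) => [j ->|->]; last exact: Ax.
by rewrite tnthS; exact: At.
Qed.

Section succ.
Variables (n : nat) (mu : {sigma_finite_measure set (n.-tuple mR) -> \bar R}).

Definition lebesgue_tupleS : set (n.+1.-tuple mR) -> \bar R :=
  pushforward (@lebesgue_measure R \x mu) (@cons_tuple_pair n).

Let preimage_measurable A :
  measurable A -> measurable (@cons_tuple_pair n @^-1` A).
Proof.
move=> mA; rewrite -[X in measurable X]setTI.
exact: measurable_cons_tuple_pair.
Qed.

Let lebesgue_tupleS0 : lebesgue_tupleS set0 = 0.
Proof. by rewrite /lebesgue_tupleS /pushforward preimage_set0 measure0. Qed.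

Let lebesgue_tupleS_ge0 A : 0 <= lebesgue_tupleS A.
Proof. exact: integral_ge0. Qed.

Let lebesgue_tupleS_sigma_additive : semi_sigma_additive lebesgue_tupleS.
Proof.
move=> F mF tF mUF; rewrite /lebesgue_tupleS /pushforward preimage_bigcup.
apply: measure_semi_sigma_additive.
- by move=> k; exact: preimage_measurable.
- apply/trivIsetP => /= i j _ _ ij; rewrite -preimage_setI.
  by move/trivIsetP : tF => /(_ _ _ _ _ ij) ->//; rewrite preimage_set0.
- by rewrite -preimage_bigcup; exact: preimage_measurable.
Qed.

HB.instance Definition _ := isMeasure.Build _ _ _ lebesgue_tupleS
  lebesgue_tupleS0 lebesgue_tupleS_ge0 lebesgue_tupleS_sigma_additive.

Let lebesgue_tupleS_sigma_finite : sigma_finite setT lebesgue_tupleS.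
Proof.
have /sigma_finiteP[F [FT ndF Ffin]] := sigma_finiteT (@lebesgue_measure R).
have /sigma_finiteP[G [GT ndG Gfin]] := sigma_finiteT mu.
pose uncons (t : n.+1.-tuple mR) : mR * n.-tuple mR :=
  (thead t, [tuple of behead t]).
exists (fun i => uncons @^-1` (F i `*` G i)).
  apply/seteqP; split=> // t _.
  have [i _ Fi] : (\bigcup_i F i) (uncons t).1 by rewrite -FT.
  have [j _ Gj] : (\bigcup_i G i) (uncons t).2 by rewrite -GT.
  exists (maxn i j) => //; split.
  - by move: Fi; exact/subsetPset/ndF/leq_maxl.
  - by move: Gj; exact/subsetPset/ndG/leq_maxr.
move=> i; have [mF Fi] := Ffin i; have [mG Gi] := Gfin i; split.
  have muncons : measurable_fun setT uncons.
    apply/measurable_fun_pairP; split; last exact: measurable_behead.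
    exact: measurable_tnth.
  rewrite -[X in measurable X]setTI; apply: muncons => //.
  exact: measurableX.
rewrite /lebesgue_tupleS /pushforward.
have -> : @cons_tuple_pair n @^-1` (uncons @^-1` (F i `*` G i)) = F i `*` G i.
  have unconsK : cancel (@cons_tuple_pair n) uncons.
    by move=> [x t]; congr pair; exact: val_inj.
  by rewrite -comp_preimage (_ : uncons \o _ = id) ?preimage_id//; exact/funext.
by rewrite product_measure1E// lte_mul_pinfty// ge0_fin_numE.
Qed.

HB.instance Definition _ := Measure_isSigmaFinite.Build _ _ _ lebesgue_tupleS
  lebesgue_tupleS_sigma_finite.

End succ.

(* Lebesgue measure on R^n, as the n-fold product of [lebesgue_measure] on the
   Borel sets; [lebesgue_tuple_box] computes it on measurable boxes. *)
Fixpoint lebesgue_tuple n : {sigma_finite_measure set (n.-tuple mR) -> \bar R} :=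
  if n is n'.+1 return {sigma_finite_measure set (n.-tuple mR) -> \bar R} then
    lebesgue_tupleS (lebesgue_tuple n')
  else \d_([tuple]).

Lemma lebesgue_tuple_box n (A : 'I_n -> set mR) :
  (forall i, measurable (A i)) ->
  lebesgue_tuple n [set t | forall i, A i (tnth t i)] =
  \prod_(i < n) @lebesgue_measure R (A i).
Proof.
elim: n => [|n IHn] in A *.
  by move=> _; rewrite big_ord0 /= diracE mem_set// => -[].
move=> mA; rewrite big_ord_recl -IHn//.
rewrite [LHS]/= /lebesgue_tupleS /pushforward box_cons product_measure1E//.
by apply: (@measurable_tuple_box n (fun i => A (lift ord0 i))) => i; exact: mA.
Qed.

End lebesgue_measure_tuple.

Section gelfand_shilov.
Context (R : realType) (n : nat).
Local Notation Rn := 'rV[R]_n.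
Local Notation C := R[i].
Local Notation Re := (@complex.Re R).
Local Notation Im := (@complex.Im R).
Implicit Types (g : Rn -> R) (f : Rn -> C) (a b : {ffun 'I_n -> nat}).

Definition partial (i : 'I_n) g : Rn -> R := fun x => 'D_(delta_mx 0 i) g x.

Fixpoint is_Ck (k : nat) g : Prop :=
  continuous g /\
  if k is k'.+1 then
    forall i, (forall x, derivable g x (delta_mx 0 i)) /\ is_Ck k' (partial i g)
  else True.

Definition smooth f : Prop :=
  forall k, is_Ck k (Re \o f) /\ is_Ck k (Im \o f).

Definition mindex_size a : nat := (\sum_(i < n) a i)%N.

Definition monomial a (x : Rn) : R := \prod_(i < n) x 0 i ^+ a i.

(* $\partial_0^{b_0} \dots \partial_{n-1}^{b_{n-1}} g$; the order is immaterial
   on smooth functions. *)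
Definition mpartial b g : Rn -> R :=
  foldr (fun i h => iter (b i) (partial i) h) g (enum 'I_n).

Definition cmpartial b f : Rn -> C :=
  fun x => (mpartial b (Re \o f) x +i* mpartial b (Im \o f) x)%C.

Definition Mseq (tau sigma : R) (p : nat) : R :=
  if p == 0%N then 1 else p%:R `^ (tau * p%:R `^ sigma).

Definition GS_estimate (tau sigma c : R) f : Prop := forall a b,
  (ereal_sup [set (ComplexField.Normc.normc ((monomial a x)%:C%C * cmpartial b f x))%:E
             | x in [set: Rn]]
   <= (c * Mseq tau sigma (mindex_size a) * Mseq tau sigma (mindex_size b))%:E)%E.

Definition GS_roumieu (sigma : R) : set (Rn -> C) :=
  [set f | smooth f /\
    exists2 tau, 0 < tau & exists2 c, 0 < c & GS_estimate tau sigma c f].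

Definition GS_beurling (sigma : R) : set (Rn -> C) :=
  [set f | smooth f /\
    forall tau, 0 < tau -> exists2 c, 0 < c & GS_estimate tau sigma c f].

Definition row_of_tuple (t : n.-tuple (measurableTypeR R)) : Rn :=
  \row_i tnth t i.

Definition integralRn g : R :=
  \int[lebesgue_tuple R n]_t g (row_of_tuple t).

Definition cintegralRn f : C :=
  (integralRn (Re \o f) +i* integralRn (Im \o f))%C.

Definition dotRn (x y : Rn) : R := \sum_(i < n) x 0 i * y 0 i.

(* $e^{i\theta}$ *)
Definition expi (theta : R) : C := (cos theta +i* sin theta)%C.

Definition fourier f : Rn -> C :=
  fun xi => cintegralRn (fun x => f x * expi (- (2 * pi * dotRn x xi))).

End gelfand_shilov.
Arguments GS_roumieu {R} n sigma.
Arguments GS_beurling {R} n sigma.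

(* Main.v *)
From HB Require Import structures.
Require Import Defs.
From mathcomp Require Import all_boot all_order all_algebra.
From mathcomp Require Import complex.
From mathcomp Require Import all_classical all_reals all_analysis.
From mathcomp Require Import measurable_realfun.
From mathcomp Require Import ring lra.

(** Multiplication by coordinates and differentiation are exchanged by the
    Fourier transform, so [xi^alpha d^beta F f] is, up to powers of [2 pi], the
    transform of [d^alpha (x^beta f)].  It is therefore bounded by the supremum
    of that function multiplied by [\prod_i (1 + x_i^2)], the inverse of an
    integrable weight.  The Leibniz rule turns this function into a sum of terms
    [x^e d^d f] with [|e| <= |beta|], [|d| <= |alpha|] and total coefficient at
    most [(1 + |beta|)^|alpha|], and the weight adds at most [2 n] to the degree
    of the monomials.  Altogether one obtains
    [(2 pi)^q (1 + q)^p M_{2n+q} M_p] with [p = |alpha|], [q = |beta|].  Since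
    [sigma > 1], the sequence [M] grows so fast that the two powers and the shift
    of the index are all absorbed by multiplying [tau] by a constant that depends
    on [sigma] only ([Mseq_absorb]).  This loss is harmless in the Roumieu case,
    where [tau] is existentially quantified, and in the Beurling case, where one
    starts from a smaller [tau]: both spaces are stable under the transform
    ([controlled_cosT]).  Surjectivity follows from the inversion formula
    [F (F f) x = f (- x)] ([fourierK]): the fourth power of [F] is the identity
    on these spaces, so that [f] is the transform of [F (F (F f))].

    The whole argument is carried out for real functions, with the transforms
    [cosT theta g xi], the integral of [g x * cos (2 pi x.xi + theta)].  Real and
    imaginary parts of the Fourier transform are sums of two of them, and a shift
    of [theta] by [pi / 2] plays the role of the multiplication by [i]: one has
    [d_j (cosT theta g) = 2 pi cosT (theta + pi / 2) (x_j g)]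
    ([is_derive_cosT]) and
    [2 pi xi_j cosT theta g = cosT (theta + pi / 2) (d_j g)] ([cosT_partial]).
    No limit is taken under the integral sign in these two formulas: a Taylor
    bound, quadratic in the increment, is integrated instead.

    Inversion ([cosT_inversion]) is obtained by Gaussian regularisation: the
    double integral is multiplied by [exp (- pi e^2 |xi|^2)], Fubini's theorem
    reduces it to the transform of a Gaussian, which is known from a differential
    equation along rays ([cosT_gauss]), and [e] tends to [0].

    Iterated partial derivatives are indexed by words of coordinates.  The
    derivative of a multi-index corresponds to the increasing word, and the
    Leibniz rule and the integrations by parts only ever produce increasing
    words, so partial derivatives are never interchanged. *)

Set Implicit Arguments.
Unset Strict Implicit.
Unset Printing Implicit Defensive.

Import Order.TTheory GRing.Theory Num.Theory.
Import numFieldNormedType.Exports.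

Local Open Scope classical_set_scope.
Local Open Scope ring_scope.

(** * Product integrals: Tonelli, affine substitutions, products *)

Section tuple_integral.
Context {R : realType}.
Local Notation mR := (measurableTypeR R).
Local Notation leb := (@lebesgue_measure R).
Local Notation lebn := (lebesgue_tuple R).
Local Open Scope ereal_scope.

Lemma ge0_integral_tupleS n (G : n.+1.-tuple mR -> \bar R) :
  measurable_fun [set: n.+1.-tuple mR] G -> (forall t, 0 <= G t) ->
  \int[lebn n.+1]_t G t =
  \int[leb]_x \int[lebn n]_t G (@cons_tuple_pair R n (x, t)).
Proof.
move=> mG G0.
rewrite [LHS](@ge0_integral_pushforward _ _ _ _ R (@cons_tuple_pair R n)
  (@measurable_cons_tuple_pair R n) (leb \x lebn n) setT G)//.
rewrite preimage_setT.
have mGc := measurableT_comp mG (@measurable_cons_tuple_pair R n).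
exact: (fubini_tonelli1 _ mGc (fun p => G0 _)).
Qed.

(** It suffices to compare [lebesgue_measure] with the scaled image measure on
    half-open intervals. *)
Lemma ge0_integral_affine (a e : R) (g : mR -> \bar R) : (0 < e)%R ->
  measurable_fun [set: mR] g -> (forall x, 0 <= g x) ->
  e%:E * \int[leb]_x g (a + e * x)%R = \int[leb]_x g x.
Proof.
move=> e0 mg g0.
pose psi (x : mR) : mR := (a + e * x)%R.
have mpsi : measurable_fun [set: mR] psi.
  by apply: measurable_funD => //; exact: measurable_funM.
pose pm : {measure set mR -> \bar R} :=
  measure_function_pushforward__canonical__measure_function_Measure leb mpsi.
pose m := mscale (NngNum (ltW e0)) pm.
have mE A : measurable A -> leb A = m A.
  apply: (@lebesgue_measure_unique R m) => _ [[c d] _ <-] /=.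
  rewrite lebesgue_measure_itv/= /m /mscale /= /pushforward.
  have -> : psi @^-1` `]c, d] = `](e^-1 * (c - a))%R, (e^-1 * (d - a))%R]%classic.
    apply/seteqP; split=> x /=; rewrite !in_itv/= ler_pdivlMl// ltr_pdivrMl// /psi.
      by move=> /andP[? ?]; lra.
    by move=> /andP[? ?]; lra.
  rewrite lebesgue_measure_itv/= !lte_fin ltr_pM2l ?invr_gt0// ltrD2r.
  case: ifPn => cd; last by rewrite mule0.
  by rewrite -!EFinB -EFinM; congr EFin; field; rewrite gt_eqF.
transitivity (\int[m]_x g x); last first.
  by apply: eq_measure_integral => A mA _; exact/esym/mE.
rewrite /m ge0_integral_mscale//; congr (_ * _).
by rewrite ge0_integral_pushforward.
Qed.

Definition tuple_affine n (a : 'I_n -> R) (e : R) (t : n.-tuple mR) : n.-tuple mR :=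
  [tuple (a i + e * tnth t i)%R | i < n].

Lemma measurable_tuple_affine n (a : 'I_n -> R) e :
  measurable_fun [set: n.-tuple mR] (tuple_affine a e).
Proof.
apply/measurable_fun_tnthP => i /=.
rewrite (_ : _ \o _ = fun t : n.-tuple mR => (a i + e * tnth t i)%R); last first.
  by apply/funext => t /=; rewrite tnth_mktuple.
apply: measurable_funD => //; apply: measurable_funM => //.
exact: measurable_tnth.
Qed.

(** Tonelli's theorem peels off the first coordinate, where the one-dimensional
    substitution applies. *)
Lemma ge0_integral_tuple_affine n (a : 'I_n -> R) (e : R)
    (G : n.-tuple mR -> \bar R) : (0 < e)%R ->
  measurable_fun [set: n.-tuple mR] G -> (forall t, 0 <= G t) ->
  (e ^+ n)%:E * \int[lebn n]_t G (tuple_affine a e t) = \int[lebn n]_t G t.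
Proof.
move=> e0; elim: n a G => [|n IH] a G mG G0.
  rewrite expr0 mul1e; apply: eq_integral => t _; congr G.
  by rewrite (tuple0 t) (tuple0 (tuple_affine _ _ _)).
have maff m (b : 'I_m -> R) := measurable_tuple_affine b e.
have mGc := measurableT_comp mG (@measurable_cons_tuple_pair R n).
have mGa := measurableT_comp mG (maff _ a).
have mGac := measurableT_comp mGa (@measurable_cons_tuple_pair R n).
rewrite (ge0_integral_tupleS mGa (fun t => G0 _)) (ge0_integral_tupleS mG G0).
rewrite exprS EFinM -muleA -ge0_integralZl//; last 3 first.
- exact: (measurable_fun_fubini_tonelli_F _ mGac (fun p => G0 _)).
- by move=> x _; apply: integral_ge0 => t _; exact: G0.
- by rewrite lee_fin exprn_ge0// ltW.
rewrite -[RHS](ge0_integral_affine (a ord0) e0); last 2 first.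
- exact: (measurable_fun_fubini_tonelli_F _ mGc (fun p => G0 _)).
- by move=> x; apply: integral_ge0 => t _; exact: G0.
congr (_ * _); apply: eq_integral => x _.
rewrite -(IH (fun i => a (lift ord0 i)) (fun t => G (cons_tuple_pair (_, t))))//; last first.
  exact: (measurableT_comp mGc (pair1_measurable _)).
congr (_ * _); apply: eq_integral => t _; congr G.
apply: eq_from_tnth => i; rewrite tnth_mktuple.
case: (unliftP ord0 i) => [j ->|->] //.
by rewrite !tnthS tnth_mktuple.
Qed.

Lemma ge0_integral_tuple_prod n (f : R -> R) : measurable_fun [set: mR] f ->
  (forall x, 0 <= f x)%R ->
  \int[lebn n]_t (\prod_(i < n) f (tnth t i))%:E = (\int[leb]_x (f x)%:E) ^+ n.
Proof.
move=> mf f0; elim: n => [|n IH].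
  under eq_integral do rewrite big_ord0.
  by rewrite integral_dirac// diracT mul1e.
rewrite ge0_integral_tupleS; last 2 first.
- apply/measurable_EFinP; apply: measurable_prod => i _.
  by apply: measurableT_comp => //; exact: measurable_tnth.
- by move=> t; rewrite lee_fin prodr_ge0.
have cE x (t : n.-tuple mR) : (\prod_(i < n.+1) f (tnth (cons_tuple_pair (x, t)) i))%:E
   = (f x)%:E * (\prod_(i < n) f (tnth t i))%:E.
  rewrite big_ord_recl EFinM; congr (_ * _%:E).
  by apply: eq_bigr => i _; rewrite tnthS.
under eq_integral => x _.
  under eq_integral do rewrite cE.
  rewrite ge0_integralZl//; last 3 first.
  - apply/measurable_EFinP; apply: measurable_prod => i _.
    by apply: measurableT_comp => //; exact: measurable_tnth.
  - by move=> t _; rewrite lee_fin prodr_ge0.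
  - by rewrite lee_fin.
  over.
rewrite ge0_integralZr//; last 3 first.
- exact/measurable_EFinP.
- by move=> x _; rewrite lee_fin.
- by apply: integral_ge0 => t _; rewrite lee_fin prodr_ge0.
by rewrite IH expeS.
Qed.

End tuple_integral.

(** * Borel measurability of continuous functions *)

Section rn_measurable.
Context {R : realType} {n : nat}.
Local Notation mR := (measurableTypeR R).
Local Notation Rn := 'rV[R]_n.
Local Notation rot := (@row_of_tuple R n).

(** An open set is the union of the boxes with rational centre and radius
    [1 / (k + 1)] that it contains, and these are countably many. *)
Lemma measurable_open_row (U : set Rn) : open U ->
  measurable ((rot @^-1` U) : set (n.-tuple mR)).
Proof.
move=> oU.
pose box (p : 'rV[rat]_n * nat) : set (n.-tuple mR) :=
  [set t | forall i, `](ratr (p.1 0 i) - p.2.+1%:R^-1), (ratr (p.1 0 i) + p.2.+1%:R^-1)[%classic (tnth t i)].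
pose F p := if `[< box p `<=` rot @^-1` U >] then box p else set0.
have -> : rot @^-1` U = \bigcup_p F p.
  have itv_sym (a b d : R) : a - d < b < a + d -> b - d < a < b + d.
    by move=> /andP[? ?]; apply/andP; split; lra.
  have itv_dist (a x y d e : R) : d < e / 2 ->
      a - d < x < a + d -> a - d < y < a + d -> `|x - y| < e.
    by move=> ? /andP[? ?] /andP[? ?]; rewrite ltr_norml; apply/andP; split; lra.
  apply/seteqP; split=> [t /= Ut|t [p _]]; last first.
    by rewrite /F; case: asboolP => // sub /sub.
  have /nbhs_ballP[e /= e0 sub] := oU _ Ut.
  have [k] : exists k : nat, k.+1%:R^-1 < e / 2.
    exists (Num.truncn ((e / 2)^-1)).
    rewrite invf_plt ?posrE ?divr_gt0//.
    by rewrite truncnS_gt.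
  move=> ke.
  have /choice[q qE] : forall i, exists q : rat, tnth t i - k.+1%:R^-1 < ratr q < tnth t i + k.+1%:R^-1.
    move=> i; have /rat_in_itvoo[q] : tnth t i - k.+1%:R^-1 < tnth t i + k.+1%:R^-1.
      by rewrite ltrBlDr -addrA ltrDl addr_gt0// invr_gt0.
    by rewrite in_itv/= => ?; exists q.
  exists (\row_i q i, k) => //; rewrite /F.
  have boxt : box (\row_i q i, k) t.
    move=> i /=; rewrite in_itv/= mxE.
    exact: itv_sym (qE i).
  case: asboolP => // -[] s boxs; apply: sub; split => // i0 i.
  rewrite ord1 -ball_normE /= !mxE.
  have := boxs i; have := boxt i; rewrite /= !in_itv/= mxE.
  exact: itv_dist ke.
apply: countable_bigcupT_measurable; first exact: countableP.
move=> p; rewrite /F; case: asboolP => // _.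
apply: (@measurable_tuple_box R n (fun i => `]_, _[%classic)) => i.
exact: measurable_itv.
Qed.

Lemma measurable_continuous_row (g : Rn -> R) : continuous g ->
  measurable_fun [set: n.-tuple mR] (g \o rot).
Proof.
move=> /continuousP cg; apply: (measurability _ (RGenOpens.measurableE R)).
move=> _ [_ [a [b ->]] <-]; rewrite setTI comp_preimage.
by apply: measurable_open_row; apply: cg; exact: interval_open.
Qed.

End rn_measurable.

(** * Taylor bounds and derivatives *)

Section one_variable.
Context {R : realType}.
Implicit Types (f df ddf : R -> R).

Lemma mvt_unit f df (a s : R) : (forall x, is_derive x (1:R) f (df x)) ->
  exists2 c, 0 <= c <= 1 & f (a + s) - f a = s * df (a + c * s).
Proof.
move=> fdf; pose phi t := f (a + t * s).
have dphi x : is_derive x (1:R) phi (s * df (a + x * s)).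
  have dlin : is_derive x (1:R) (fun t : R => a + t * s) s.
    have -> : (fun t : R => a + t * s) = cst a + s \*: @id R.
      by apply/funext => t; rewrite !fctE mulrC.
    by apply: is_derive_eq; rewrite add0r scaler1.
  have := @is_derive1_comp R f (fun t : R => a + t * s) x _ _ (fdf _) dlin.
  by rewrite mulrC.
have [||c c01 phiE] := @MVT_segment R phi (fun x => s * df (a + x * s)) 0 1.
- exact: ler01.
- apply: continuous_subspaceT => x.
  by apply: differentiable_continuous; apply/derivable1_diffP; apply: ex_derive.
exists c; first by move: c01; rewrite in_itv.
by move: phiE; rewrite /phi mul1r mul0r addr0 subr0 mulr1.
Qed.

Lemma taylor2_bound f df ddf (M a s : R) :
  (forall x, is_derive x (1:R) f (df x)) -> (forall x, is_derive x (1:R) df (ddf x)) ->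
  (forall c, 0 <= c <= 1 -> `|ddf (a + c * s)| <= M) ->
  `|f (a + s) - f a - s * df a| <= M * s ^+ 2.
Proof.
move=> fdf dfddf ddfM.
have [c /andP[c0 c1] ->] := mvt_unit a s fdf.
have [c' /andP[c'0 c'1]] := mvt_unit a (c * s) dfddf.
rewrite -mulrBr => ->.
have -> : s * (c * s * ddf (a + c' * (c * s))) = (c * ddf (a + c' * c * s)) * s ^+ 2.
  by rewrite (mulrA c'); ring.
rewrite normrM (ger0_norm (sqr_ge0 s)) ler_wpM2r ?sqr_ge0//.
rewrite normrM ger0_norm// -[leRHS]mul1r ler_pM//.
by apply: ddfM; rewrite mulr_ge0//= mulr_ile1.
Qed.

Lemma cos_lipschitz (a b : R) : `|cos a - cos b| <= `|a - b|.
Proof.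
have [c _] := @mvt_unit cos (fun x => - sin x) b (a - b) (@is_derive_cos R).
rewrite (addrC b) subrK => ->; rewrite normrM normrN -[leRHS]mulr1.
by rewrite ler_wpM2l// ler_norml sin_geN1 sin_le1.
Qed.

Lemma cos_taylor2 (a s : R) : `|cos (a + s) - cos a + s * sin a| <= s ^+ 2.
Proof.
have dsin x : is_derive x (1:R) (fun y : R => - sin y) (- cos x).
  exact: is_deriveN.
have := @taylor2_bound cos (fun x => - sin x) (fun x => - cos x) 1 a s
  (@is_derive_cos R) dsin.
rewrite mul1r mulrN opprK; apply => c _.
by rewrite normrN ler_norml cos_geN1 cos_le1.
Qed.

(** The form in which integrals depending on a parameter are differentiated: a
    quadratic bound on the error can be integrated, whereas a limit would have to
    be interchanged with the integral. *)
Lemma is_derive_quadratic (V : normedModType R) (f : V -> R) (x v : V) (d C : R) :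
  (forall h : R, `|f (h *: v + x) - f x - h * d| <= C * h ^+ 2) ->
  is_derive x v f d.
Proof.
move=> fC.
have C0 : 0 <= C.
  by have := fC 1; rewrite expr1n mulr1; apply: le_trans; exact: normr_ge0.
have cvgd : h^-1 *: ((f \o shift x) (h *: v) - f x) @[h --> 0^'] --> d.
  apply/cvgrPdist_le => e e0; near=> h.
  have h0 : h != 0 by near: h; exact: nbhs_dnbhs_neq.
  rewrite distrC /=.
  have -> : h^-1 *: (f (h *: v + x) - f x) - d = h^-1 * (f (h *: v + x) - f x - h * d).
    by rewrite /GRing.scale/= [RHS]mulrBr mulKf//.
  rewrite normrM normfV ler_pdivrMl ?normr_gt0//.
  apply: (le_trans (fC h)).
  rewrite -real_normK ?num_real// expr2 mulrA mulrC ler_wpM2l//.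
  have : `|h| <= e / (C + 1).
    near: h; apply: dnbhs0_le; rewrite divr_gt0// ltr_wpDl//.
  rewrite ler_pdivlMr ?ltr_wpDl// mulrC; apply: le_trans.
  by rewrite ler_wpM2r// lerDl.
apply: DeriveDef; first by apply/cvg_ex; exists d.
exact: cvg_lim.
Unshelve. all: by end_near. Qed.

Lemma lipschitz_at_continuous (V : normedModType R) (f : V -> R) (x : V) K :
  (forall y, `|f x - f y| <= K * `|x - y|) -> {for x, continuous f}.
Proof.
move=> lip.
have K1 : 0 < `|K| + 1 by rewrite ltr_wpDl.
apply/cvgrPdist_le => e e0; apply/nbhs_ballP; exists (e / (`|K| + 1)) => /=.
  by rewrite divr_gt0.
move=> y; rewrite -ball_normE/= ltr_pdivlMr// => /ltW Ke.
apply: (le_trans (lip y)); apply: le_trans Ke.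
by rewrite mulrC ler_wpM2l// (le_trans (ler_norm _))// lerDl.
Qed.

End one_variable.

(** * Integration over the space of row vectors *)

Section rn_integral.
Context {R : realType} {n : nat}.
Local Notation mR := (measurableTypeR R).
Local Notation Rn := 'rV[R]_n.
Local Notation rot := (@row_of_tuple R n).
Local Notation mu := (lebesgue_tuple R n).
Implicit Types (g h : Rn -> R) (x : Rn).

Definition integrableRn g := mu.-integrable [set: n.-tuple mR] (EFin \o (g \o rot)).

(** An integrable function whose inverse is a polynomial, so that bounds on
    monomial multiples of a function give bounds on its integral. *)
Definition weight x : R := \prod_(i < n) (1 + x 0 i ^+ 2)^-1.

Lemma continuous_coord (i : 'I_n) : continuous (fun x : Rn => x 0 i).
Proof. exact: coord_continuous. Qed.

Lemma continuous_addf g h : continuous g -> continuous h ->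
  continuous (fun x => g x + h x).
Proof. by move=> cg ch x; exact: (@continuousD _ _ _ g h x (cg x) (ch x)). Qed.

Lemma continuous_mulf g h : continuous g -> continuous h ->
  continuous (fun x => g x * h x).
Proof. by move=> cg ch x; exact: (@continuousM _ _ g h x (cg x) (ch x)). Qed.

Lemma continuous_compf (f : R -> R) g : continuous f -> continuous g ->
  continuous (fun x => f (g x)).
Proof. by move=> cf cg x; exact: (@continuous_comp _ _ _ g f x (cg x) (cf (g x))). Qed.

Lemma weight_gt0 x : 0 < weight x.
Proof. by apply: prodr_gt0 => i _; rewrite invr_gt0 ltr_pwDl// sqr_ge0. Qed.

Lemma continuous_prodr (I : Type) (s : seq I) (F : I -> Rn -> R) :
  (forall i, continuous (F i)) -> continuous (fun x => \prod_(i <- s) F i x).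
Proof.
move=> cF; elim: s => [|i s IH].
  rewrite (_ : (fun _ => _) = cst 1); last by apply/funext => x; rewrite big_nil.
  exact: cst_continuous.
rewrite (_ : (fun _ => _) = fun x => F i x * \prod_(i <- s) F i x).
  exact: continuous_mulf.
by apply/funext => x; rewrite big_cons.
Qed.

Lemma continuous_sumr (I : Type) (s : seq I) (F : I -> Rn -> R) :
  (forall i, continuous (F i)) -> continuous (fun x => \sum_(i <- s) F i x).
Proof.
move=> cF; elim: s => [|i s IH].
  rewrite (_ : (fun _ => _) = cst 0); last by apply/funext => x; rewrite big_nil.
  exact: cst_continuous.
rewrite (_ : (fun _ => _) = fun x => F i x + \sum_(i <- s) F i x).
  exact: continuous_addf.
by apply/funext => x; rewrite big_cons.
Qed.

Let cauchy1 (x : R) := (1 + x ^+ 2)^-1.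

Let continuous_cauchy1 : continuous cauchy1.
Proof. by move=> x; apply: continuous_oneDsqrV. Qed.

Lemma continuous_weight : continuous weight.
Proof.
apply: continuous_prodr => i.
by apply: (@continuous_compf cauchy1); [exact: continuous_cauchy1|exact: continuous_coord].
Qed.

Let integral_cauchy1 : (\int[@lebesgue_measure R]_x (cauchy1 x)%:E = pi%:E)%E.
Proof.
rewrite ge0_symfun_integralT//.
- rewrite (_ : [set x : R | _] = `[0, +oo[%classic); last first.
    by apply/seteqP; split => x/=; rewrite in_itv/= andbT.
  have := @integral0y_oneDsqr R; rewrite /oneDsqr => ->.
  by rewrite -EFinM mulrC divfK// pnatr_eq0.
- by move=> x; rewrite invr_ge0 addr_ge0// sqr_ge0.
- by move=> x /=; rewrite /cauchy1 sqrrN.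
Qed.

Lemma integrable_weight : integrableRn weight.
Proof.
apply/integrableP; split.
  apply/measurable_EFinP; exact: measurable_continuous_row continuous_weight.
under eq_integral.
  move=> t _ /=; rewrite ger0_norm; last exact/ltW/weight_gt0.
  rewrite (_ : weight _ = \prod_(i < n) cauchy1 (tnth t i)); last first.
    by apply: eq_bigr => i _; rewrite mxE.
  over.
rewrite ge0_integral_tuple_prod//.
- by rewrite integral_cauchy1 -EFin_expe ltry.
- exact: continuous_measurable_fun.
- by move=> x; rewrite invr_ge0 addr_ge0// sqr_ge0.
Qed.

Definition mass : R := integralRn weight.

Lemma mass_ge0 : 0 <= mass.
Proof. by apply: Rintegral_ge0 => t _; exact/ltW/weight_gt0. Qed.

Definition measurableRn g := measurable_fun [set: n.-tuple mR] (g \o rot).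

Lemma integrableRn_dominated g h : measurableRn g -> integrableRn h ->
  (forall x, `|g x| <= h x) -> integrableRn g.
Proof.
move=> mg ih gh; apply: le_integrable ih => //; first exact/measurable_EFinP.
by move=> t _; rewrite /= lee_fin (le_trans (gh _))// ler_norm.
Qed.

Lemma integrableRnZ g c : integrableRn g -> integrableRn (fun x => c * g x).
Proof. by move=> ig; exact: (integrableZl measurableT c ig). Qed.

Lemma integrableRn_weight g B : continuous g ->
  (forall x, `|g x| <= B * weight x) -> integrableRn g.
Proof.
move=> cg gB; apply: integrableRn_dominated gB; first exact: measurable_continuous_row.
exact/integrableRnZ/integrable_weight.
Qed.

Lemma integrableRnD g h : integrableRn g -> integrableRn h ->
  integrableRn (fun x => g x + h x).
Proof. by move=> ig ih; exact: (integrableD measurableT ig ih). Qed.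

Lemma integrableRnB g h : integrableRn g -> integrableRn h ->
  integrableRn (fun x => g x - h x).
Proof. by move=> ig ih; exact: (integrableB measurableT ig ih). Qed.

Lemma eq_integralRn g h : g =1 h -> integralRn g = integralRn h.
Proof. by move=> gh; congr integralRn; exact/funext. Qed.

Lemma integralRnD g h : integrableRn g -> integrableRn h ->
  integralRn (fun x => g x + h x) = integralRn g + integralRn h.
Proof. by move=> ig ih; exact: RintegralD. Qed.

Lemma integralRnB g h : integrableRn g -> integrableRn h ->
  integralRn (fun x => g x - h x) = integralRn g - integralRn h.
Proof. by move=> ig ih; exact: RintegralB. Qed.

Lemma integralRnZ g c : integrableRn g ->
  integralRn (fun x => c * g x) = c * integralRn g.
Proof. by move=> ig; exact: RintegralZl. Qed.

Lemma le_norm_integralRn g h : integrableRn g -> integrableRn h ->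
  (forall x, `|g x| <= h x) -> `|integralRn g| <= integralRn h.
Proof.
move=> ig ih gh; apply: (le_trans (le_normr_Rintegral _ _)) => //.
apply: le_Rintegral measurableT _ ih _; last by move=> t _; exact: gh.
exact: (@integrable_norm _ _ _ _ _ (g \o rot) ig).
Qed.

Lemma norm_integralRn_le g B : integrableRn g ->
  (forall x, `|g x| <= B * weight x) -> `|integralRn g| <= B * mass.
Proof.
move=> ig gB; rewrite -integralRnZ; last exact: integrable_weight.
exact: le_norm_integralRn (integrableRnZ _ integrable_weight) gB.
Qed.

(** Positive and negative parts are scaled separately, and [fine] commutes with
    the multiplication by [e ^+ n] at infinite values too. *)
Lemma integralRn_affine (a : Rn) (e : R) g : 0 < e -> measurableRn g ->
  e ^+ n * integralRn (fun x => g (a + e *: x)) = integralRn g.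
Proof.
move=> e0 mg; pose A := fun i : 'I_n => a 0 i.
have affE t : rot (tuple_affine A e t) = a + e *: rot t.
  by apply/rowP => i; rewrite !mxE tnth_mktuple.
pose F (t : n.-tuple mR) := (g (rot t))%:E.
have mF : measurable_fun [set: n.-tuple mR] F by exact/measurable_EFinP.
have -> : integralRn (fun x => g (a + e *: x)) =
          fine (\int[mu]_t (F (tuple_affine A e t)))%E.
  by congr fine; apply: eq_integral => t _; rewrite /F affE.
rewrite /integralRn /Rintegral [in LHS]integralE [in RHS]integralE.
rewrite -[in RHS](ge0_integral_tuple_affine A e0 (measurable_funepos mF))//.
rewrite -[in RHS](ge0_integral_tuple_affine A e0 (measurable_funeneg mF))//.
have en0 : (0 < (e ^+ n)%:E)%E by rewrite lte_fin exprn_gt0.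
have scaleB (u v : \bar R) : ((e ^+ n)%:E * u - (e ^+ n)%:E * v = (e ^+ n)%:E * (u - v))%E.
  case: u v => [u| |] [v| |]; rewrite ?gt0_muley ?gt0_muleNy//=.
  by rewrite -EFinM; congr EFin; rewrite mulrBr.
have scalef (u : \bar R) : e ^+ n * fine u = fine ((e ^+ n)%:E * u)%E.
  by case: u => [u| |]; rewrite ?gt0_muley ?gt0_muleNy//= mulr0.
rewrite scaleB scalef; congr (fine (_ * (_ - _))%E); apply: eq_integral => t _.
  by rewrite !funeposE.
by rewrite !funenegE.
Qed.

End rn_integral.

(** * Rapidly decreasing functions and their cosine transforms *)

Section rapid.
Context {R : realType} {n : nat}.
Local Notation Rn := 'rV[R]_n.
Implicit Types (g h : Rn -> R) (x xi y : Rn) (v w : seq 'I_n).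

Definition word_monomial v x : R := \prod_(i <- v) x 0 i.

Lemma word_monomial_cons i v x : word_monomial (i :: v) x = x 0 i * word_monomial v x.
Proof. by rewrite /word_monomial big_cons. Qed.

Lemma word_monomial_cat v w x :
  word_monomial (v ++ w) x = word_monomial v x * word_monomial w x.
Proof. by rewrite /word_monomial big_cat. Qed.

(** The inverse of the weight is a sum of [2 ^ n] monomials of degree at most
    [2 * n]. *)
Lemma weight_bound x (a B : R) :
  (forall v, (size v <= 2 * n)%N -> `|word_monomial v x * a| <= B) ->
  `|a| <= 2 ^+ n * B * weight x.
Proof.
move=> aB.
have main s v : (size v + 2 * size s <= 2 * n)%N ->
    `|word_monomial v x * a| * \prod_(i <- s) (1 + x 0 i ^+ 2) <= 2 ^+ size s * B.
  elim: s v => [|i s IH] v /=.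
    by rewrite big_nil mulr1 expr0 mul1r muln0 addn0; exact: aB.
  move=> vs; rewrite big_cons mulrDl mul1r mulrDr.
  have -> : 2 ^+ (size s).+1 * B = 2 ^+ size s * B + 2 ^+ size s * B by rewrite exprS; ring.
  apply: lerD.
    by apply: IH; apply: leq_trans vs; rewrite leq_add2l leq_mul2l leqnSn.
  rewrite mulrA (mulrC _ (x 0 i ^+ 2)).
  have -> : x 0 i ^+ 2 * `|word_monomial v x * a| = `|word_monomial (i :: i :: v) x * a|.
    by rewrite !word_monomial_cons -[X in X * _]ger0_norm ?sqr_ge0// -normrM; congr `|_|; ring.
  by apply: IH; move: vs; rewrite mulnS addnA addn2.
have := main (index_enum 'I_n) [::].
rewrite /word_monomial big_nil mul1r.
rewrite (_ : size (index_enum 'I_n) = n); last by rewrite [index_enum _]unlock -enumT size_enum_ord.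
move=> /(_ (leqnn _)) => le1.
rewrite /weight prodfV ler_pdivlMr//.
by apply: prodr_gt0 => i _; rewrite ltr_pwDl// sqr_ge0.
Qed.

(** The class in which every integral below converges; it is stable under
    multiplication by coordinates and by bounded continuous functions. *)
Definition rapid g :=
  continuous g /\ forall v, exists C, forall x, `|word_monomial v x * g x| <= C.

Lemma rapid_weight g : rapid g -> exists C, forall x, `|g x| <= C * weight x.
Proof.
move=> [_ gC]; have /choice[C CE] := gC.
(* the sum of the constants of all words of length at most [2 * n] bounds each
   of them *)
pose W := flatten [seq [seq tval t | t <- enum {: k.-tuple 'I_n}] | k <- iota 0 (2 * n).+1].
have C0 v : 0 <= C v by apply: le_trans (CE v 0); exact: normr_ge0.
exists (2 ^+ n * \sum_(v <- W) C v) => x; apply: weight_bound => v sv.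
apply: (le_trans (CE v x)).
have vW : v \in W.
  apply/flatten_mapP; exists (size v); first by rewrite mem_iota/= add0n ltnS.
  by apply/mapP; exists (in_tuple v); rewrite ?mem_enum.
by rewrite (big_rem v)//= lerDl sumr_ge0.
Qed.

Lemma rapid_integrable g : rapid g -> integrableRn g.
Proof.
by move=> gS; have [C] := rapid_weight gS; apply: integrableRn_weight; case: gS.
Qed.

Lemma rapid_continuous g : rapid g -> continuous g.
Proof. by case. Qed.

Lemma rapidD g h : rapid g -> rapid h -> rapid (fun x => g x + h x).
Proof.
move=> [cg gC] [ch hC]; split=> [|v]; first exact: continuous_addf.
have [C CE] := gC v; have [D DE] := hC v; exists (C + D) => x.
by rewrite mulrDr (le_trans (ler_normD _ _))// lerD.
Qed.

Lemma rapid_mul_bounded M g h : rapid g -> continuous h ->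
  (forall x, `|h x| <= M) -> rapid (fun x => g x * h x).
Proof.
move=> [cg gC] ch hM; split=> [|v]; first exact: continuous_mulf.
have [C CE] := gC v; exists (C * M) => x.
by rewrite mulrA normrM ler_pM.
Qed.

Lemma rapidZ (c : R) g : rapid g -> rapid (fun x => c * g x).
Proof.
move=> gS; rewrite (_ : (fun _ => _) = fun x => g x * cst c x).
  by apply: (rapid_mul_bounded (M := `|c|)) => //; exact: cst_continuous.
by apply/funext => x; rewrite mulrC.
Qed.

Lemma rapid0 : rapid (fun=> 0).
Proof.
split=> [|v]; first exact: cst_continuous.
by exists 0 => x; rewrite mulr0 normr0.
Qed.

Lemma rapid_sum (I : Type) (s : seq I) (F : I -> Rn -> R) :
  (forall i, rapid (F i)) -> rapid (fun x => \sum_(i <- s) F i x).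
Proof.
move=> FS; elim: s => [|i s IH].
  rewrite (_ : (fun _ => _) = fun=> 0); first exact: rapid0.
  by apply/funext => x; rewrite big_nil.
rewrite (_ : (fun _ => _) = fun x => F i x + \sum_(j <- s) F j x).
  exact: rapidD.
by apply/funext => x; rewrite big_cons.
Qed.

Lemma rapid_coord i g : rapid g -> rapid (fun x => x 0 i * g x).
Proof.
move=> [cg gC]; split=> [|v].
  by apply: continuous_mulf => //; exact: continuous_coord.
have [C CE] := gC (i :: v); exists C => x.
by have := CE x; rewrite word_monomial_cons mulrA (mulrC (word_monomial _ _)).
Qed.

Lemma rapid_word v g : rapid g -> rapid (fun x => word_monomial v x * g x).
Proof.
move=> gS; elim: v => [|i v IH].
  rewrite (_ : (fun _ => _) = g)//.
  by apply/funext => x; rewrite /word_monomial big_nil mul1r.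
rewrite (_ : (fun _ => _) = fun x => x 0 i * (word_monomial v x * g x)).
  exact: rapid_coord.
by apply/funext => x; rewrite word_monomial_cons mulrA.
Qed.

Lemma rapid_dot y g : rapid g -> rapid (fun x => dotRn x y * g x).
Proof.
move=> gS; rewrite (_ : (fun _ => _) = fun x => \sum_i (y 0 i * (x 0 i * g x))).
  by apply: rapid_sum => i; apply: rapidZ; exact: rapid_coord.
apply/funext => x; rewrite mulr_suml; apply: eq_bigr => i _.
by rewrite mulrA (mulrC (y 0 i)).
Qed.

Lemma continuous_dot y : continuous (fun x => dotRn x y).
Proof.
apply: continuous_sumr => i; apply: continuous_mulf; last exact: cst_continuous.
exact: continuous_coord.
Qed.

Lemma dotRnDr x y z : dotRn x (y + z) = dotRn x y + dotRn x z :> R.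
Proof. by rewrite -big_split; apply: eq_bigr => i _ /=; rewrite mxE mulrDr. Qed.

Lemma dotRnZr (c : R) x y : dotRn x (c *: y) = c * dotRn x y.
Proof. by rewrite mulr_sumr; apply: eq_bigr => i _; rewrite mxE mulrCA. Qed.

Lemma dotRnC x y : dotRn x y = dotRn y x.
Proof. by apply: eq_bigr => i _; rewrite mulrC. Qed.

Lemma dotRnDl x y z : dotRn (x + y) z = dotRn x z + dotRn y z :> R.
Proof. by rewrite dotRnC dotRnDr !(dotRnC z). Qed.

Lemma dotRnZl (c : R) x y : dotRn (c *: x) y = c * dotRn x y.
Proof. by rewrite dotRnC dotRnZr dotRnC. Qed.

Lemma dotRn_delta x (i : 'I_n) : dotRn x (delta_mx 0 i) = x 0 i :> R.
Proof.
rewrite /dotRn (bigD1 i)//= mxE !eqxx mulr1 big1 ?addr0// => j ji.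
by rewrite mxE eqxx (negbTE ji) mulr0.
Qed.

Definition wave (theta : R) xi x : R := cos (2 * pi * dotRn x xi + theta).

(** The real and imaginary parts of the Fourier transform are combinations of
    these transforms with [theta] equal to [0], [pi / 2] and [- (pi / 2)]. *)
Definition cosT (theta : R) g xi : R := integralRn (fun x => g x * wave theta xi x).

Lemma continuous_wave theta xi : continuous (wave theta xi).
Proof.
apply: continuous_compf; first exact: continuous_cos.
apply: continuous_addf; last exact: cst_continuous.
apply: continuous_mulf; first exact: cst_continuous.
exact: continuous_dot.
Qed.

Lemma wave_le1 theta xi x : `|wave theta xi x| <= 1.
Proof. by rewrite ler_norml cos_geN1 cos_le1. Qed.

Lemma rapid_wave theta xi g : rapid g -> rapid (fun x => g x * wave theta xi x).
Proof.
move=> gS; apply: (rapid_mul_bounded (M := 1)) => //.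
  exact: continuous_wave.
exact: wave_le1.
Qed.

Lemma cosTD theta g h xi : rapid g -> rapid h ->
  cosT theta (fun x => g x + h x) xi = cosT theta g xi + cosT theta h xi.
Proof.
move=> gS hS; rewrite -integralRnD; try exact/rapid_integrable/rapid_wave.
by apply: eq_integralRn => x; rewrite mulrDl.
Qed.

Lemma cosTZ theta c g xi : rapid g ->
  cosT theta (fun x => c * g x) xi = c * cosT theta g xi.
Proof.
move=> gS; rewrite -integralRnZ; last exact/rapid_integrable/rapid_wave.
by apply: eq_integralRn => x; rewrite mulrA.
Qed.

Lemma cosT_bound theta g xi C : rapid g -> (forall x, `|g x| <= C * weight x) ->
  `|cosT theta g xi| <= C * mass (n := n).
Proof.
move=> gS gC; apply: norm_integralRn_le; first exact/rapid_integrable/rapid_wave.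
move=> x; rewrite normrM -[leRHS]mulr1 ler_pM//; exact: wave_le1.
Qed.

(** The second-order Taylor bound for [cos] makes the error at most
    [s ^+ 2 * (2 * pi * dotRn x y) ^+ 2 * `|g x|] under the integral. *)
Lemma is_derive_cosT theta g xi y : rapid g ->
  is_derive xi y (cosT theta g)
    (2 * pi * cosT (theta + pi / 2) (fun x => dotRn x y * g x) xi).
Proof.
move=> gS.
have yyS := rapid_dot y (rapid_dot y gS).
have [C CE] := rapid_weight yyS.
apply: (@is_derive_quadratic _ _ _ _ _ _ ((2 * pi) ^+ 2 * C * mass (n := n))) => s.
have iw th zeta f : rapid f -> integrableRn (fun x => f x * wave th zeta x).
  by move=> fS; exact/rapid_integrable/rapid_wave.
rewrite -cosTZ; last exact: rapid_dot.
rewrite -cosTZ; last exact/rapidZ/rapid_dot.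
have iB : integrableRn (fun x => g x * wave theta (s *: y + xi) x - g x * wave theta xi x).
  by apply: integrableRnB; exact: iw.
have i3 : integrableRn (fun x => s * (2 * pi * (dotRn x y * g x)) * wave (theta + pi / 2) xi x).
  by apply: iw; apply/rapidZ/rapidZ/rapid_dot.
rewrite -[X in `|X - _|]integralRnB; [|exact: iw|exact: iw].
rewrite -integralRnB//.
rewrite mulrAC; apply: norm_integralRn_le.
  exact: integrableRnB.
move=> x; rewrite /wave dotRnDr dotRnZr.
set b := dotRn x y; set a := 2 * pi * dotRn x xi + theta.
rewrite (_ : 2 * pi * (s * b + dotRn x xi) + theta = a + 2 * pi * s * b); last by rewrite /a; ring.
rewrite addrA -/a cosDpihalf.
rewrite (_ : _ - _ - _ = g x * (cos (a + 2 * pi * s * b) - cos a + (2 * pi * s * b) * sin a)); last by ring.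
rewrite normrM.
apply: (@le_trans _ _ (`|g x| * (2 * pi * s * b) ^+ 2)).
  by rewrite ler_wpM2l// cos_taylor2.
have -> : `|g x| * (2 * pi * s * b) ^+ 2 = (2 * pi) ^+ 2 * s ^+ 2 * `|b * (b * g x)|.
  by rewrite [b * _]mulrA -expr2 [`|_ * g x|]normrM (ger0_norm (sqr_ge0 b)); ring.
rewrite [leRHS](_ : _ = (2 * pi) ^+ 2 * s ^+ 2 * (C * weight x)); last by ring.
by apply: ler_wpM2l (CE x); rewrite mulr_ge0 ?sqr_ge0.
Qed.

Lemma le_coord_norm (y : Rn) i : `|y 0 i| <= `|y|.
Proof. by rewrite [leRHS]mx_normrE; exact: (le_bigmax _ (fun p => `|y p.1 p.2|) (0, i)). Qed.

Lemma continuous_cosT theta g : rapid g -> continuous (cosT theta g).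
Proof.
move=> gS xi.
have /choice[C CE] i := rapid_weight (rapid_coord i gS).
pose K := 2 * pi * (\sum_i C i) * mass (n := n).
have lip eta : `|cosT theta g xi - cosT theta g eta| <= K * `|xi - eta|.
  have iw zeta : integrableRn (fun x => g x * wave theta zeta x).
    exact/rapid_integrable/rapid_wave.
  rewrite -integralRnB// mulrAC; apply: norm_integralRn_le; first exact: integrableRnB.
  move=> x; rewrite -mulrBr normrM.
  apply: (@le_trans _ _ (`|g x| * (2 * pi * \sum_i (`|x 0 i| * `|xi - eta|)))).
    rewrite ler_wpM2l//; apply: (le_trans (cos_lipschitz _ _)).
    rewrite opprD addrACA subrr addr0 -mulrBr normrM ger0_norm; last first.
      by rewrite mulr_ge0// pi_ge0.
    rewrite ler_wpM2l ?mulr_ge0 ?pi_ge0//.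
    have -> : dotRn x xi - dotRn x eta = \sum_i x 0 i * (xi - eta) 0 i.
      by rewrite -sumrB; apply: eq_bigr => i _; rewrite !mxE mulrBr.
    apply: (le_trans (ler_norm_sum _ _ _)); apply: ler_sum => i _.
    by rewrite normrM ler_wpM2l// le_coord_norm.
  rewrite -mulr_suml.
  have -> : `|g x| * (2 * pi * ((\sum_i `|x 0 i|) * `|xi - eta|)) =
            2 * pi * `|xi - eta| * \sum_i `|x 0 i * g x|.
    under [in RHS]eq_bigr do rewrite normrM.
    by rewrite -mulr_suml; ring.
  rewrite [leRHS](_ : _ = 2 * pi * `|xi - eta| * \sum_i (C i * weight x)); last first.
    by rewrite -mulr_suml; ring.
  by rewrite ler_wpM2l ?mulr_ge0 ?pi_ge0// ler_sum.
exact: (lipschitz_at_continuous lip).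
Qed.

End rapid.

(** * Differentiation and integration by parts *)

Section smoothness.
Context {R : realType} {n : nat}.
Local Notation Rn := 'rV[R]_n.
Local Notation e_ i := (delta_mx 0 i : Rn).
Implicit Types (g h : Rn -> R) (x xi y : Rn) (v w : seq 'I_n).

Lemma partialE i g (dg : Rn -> R) : (forall x, is_derive x (e_ i) g (dg x)) ->
  partial i g = dg.
Proof. by move=> gd; apply/funext => x; exact: derive_val. Qed.

Lemma is_derive_partial i g x : derivable g x (e_ i) ->
  is_derive x (e_ i) g (partial i g x).
Proof. exact: derivableP. Qed.

Lemma derivable_is_derive x y g (d : R) : is_derive x y g d -> derivable g x y.
Proof. by case. Qed.

Lemma is_derive_mulf x y g h (dg dh : R) : is_derive x y g dg -> is_derive x y h dh ->
  is_derive x y (fun z => g z * h z) (dg * h x + g x * dh).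
Proof.
move=> gd hd; have := is_deriveM gd hd.
by rewrite /GRing.scale/= addrC (mulrC (h x)).
Qed.

Lemma is_derive_addf x y g h (dg dh : R) : is_derive x y g dg -> is_derive x y h dh ->
  is_derive x y (fun z => g z + h z) (dg + dh).
Proof. by move=> gd hd; exact: is_deriveD. Qed.

Lemma is_derive_dotl xi y x : is_derive x y (fun z => dotRn z xi) (dotRn y xi).
Proof.
apply: (@is_derive_quadratic _ _ _ _ _ _ 0) => s.
by rewrite dotRnDl dotRnZl addrK subrr normr0 mul0r.
Qed.

Lemma is_derive_coord i j x : is_derive x (e_ i) (fun z : Rn => z 0 j) ((i == j)%:R).
Proof.
have := is_derive_dotl (e_ j) (e_ i) x.
rewrite dotRn_delta mxE eqxx /= eq_sym.
by under eq_fun do rewrite dotRn_delta.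
Qed.

Lemma is_derive_wave theta xi y x : is_derive x y (wave theta xi)
  (2 * pi * dotRn y xi * wave (theta + pi / 2) xi x).
Proof.
apply: (@is_derive_quadratic _ _ _ _ _ _ ((2 * pi * dotRn y xi) ^+ 2)) => s.
rewrite /wave dotRnDl dotRnZl addrA cosDpihalf.
set a := 2 * pi * dotRn x xi + theta; set b := dotRn y xi.
rewrite (_ : 2 * pi * (s * b + dotRn x xi) + theta = a + s * (2 * pi * b)); last by rewrite /a; ring.
rewrite !mulrN opprK -exprMn (mulrC _ s) [s * (_ * sin a)]mulrA.
exact: cos_taylor2.
Qed.

Lemma is_CkW k g : is_Ck k.+1 g -> is_Ck k g.
Proof.
elim: k g => [|k IH] g /=; first by case.
move=> [cg gi]; split=> // i; have [dg gk] := gi i; split=> //.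
exact: IH.
Qed.

Lemma is_CkD k g h : is_Ck k g -> is_Ck k h -> is_Ck k (fun x => g x + h x).
Proof.
elim: k g h => [|k IH] g h /= [cg gi] [ch hi]; split=> //; try exact: continuous_addf.
move=> i; have [dg gk] := gi i; have [dh hk] := hi i.
have dgh x := is_derive_addf (is_derive_partial (dg x)) (is_derive_partial (dh x)).
split; first by move=> x; exact: ex_derive.
by rewrite (partialE dgh); exact: IH.
Qed.

Lemma is_CkM k g h : is_Ck k g -> is_Ck k h -> is_Ck k (fun x => g x * h x).
Proof.
elim: k g h => [|k IH] g h gC hC; first by split=> //; apply: continuous_mulf; [case: gC|case: hC].
have gk := is_CkW gC; have hk := is_CkW hC.
move: gC hC => /= [cg gi] [ch hi]; split; first exact: continuous_mulf.
move=> i; have [dg gk'] := gi i; have [dh hk'] := hi i.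
have dgh x := is_derive_mulf (is_derive_partial (dg x)) (is_derive_partial (dh x)).
split; first by move=> x; exact: ex_derive.
by rewrite (partialE dgh); apply: is_CkD; exact: IH.
Qed.

Lemma is_Ck_cst k (c : R) : is_Ck k (fun _ : Rn => c).
Proof.
elim: k c => [|k IH] c /=; split=> //; try exact: cst_continuous.
move=> i; have dc x : is_derive x (e_ i) (fun=> c) 0 by exact: is_derive_cst.
by split; [move=> x; exact: ex_derive|rewrite (partialE dc); exact: IH].
Qed.

Lemma is_Ck_coord k j : is_Ck k (fun x : Rn => x 0 j).
Proof.
case: k => [|k]; split=> //; try exact: continuous_coord.
move=> i; split; first by move=> x; exact: derivable_is_derive (is_derive_coord i j x).
by rewrite (partialE (is_derive_coord i j)); exact: is_Ck_cst.
Qed.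

Lemma is_Ck_word k v : is_Ck k (word_monomial (R := R) v).
Proof.
elim: v => [|i v IH].
  rewrite (_ : word_monomial _ = fun=> 1); first exact: is_Ck_cst.
  by apply/funext => x; rewrite /word_monomial big_nil.
rewrite (_ : word_monomial _ = fun x => x 0 i * word_monomial v x).
  by apply: is_CkM => //; exact: is_Ck_coord.
by apply/funext => x; rewrite word_monomial_cons.
Qed.

Lemma partial_cosT theta g i : rapid g ->
  partial i (cosT theta g) = cosT (theta + pi / 2) (fun x => 2 * pi * (x 0 i * g x)).
Proof.
move=> gS; rewrite (partialE (fun x => is_derive_cosT theta x (e_ i) gS)).
apply/funext => xi; rewrite cosTZ; last exact: rapid_coord.
congr (_ * _); apply: eq_integralRn => x; by rewrite dotRn_delta.
Qed.

Lemma is_Ck_cosT k theta g : rapid g -> is_Ck k (cosT theta g).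
Proof.
elim: k theta g => [|k IH] theta g gS; split=> //; try exact: continuous_cosT.
move=> i; split.
  by move=> x; exact: derivable_is_derive (is_derive_cosT theta x (e_ i) gS).
by rewrite partial_cosT//; apply/IH/rapidZ/rapid_coord.
Qed.

Definition word_partial w g : Rn -> R := foldr (@partial R n) g w.

Lemma word_partial_cosT w theta g : rapid g ->
  word_partial w (cosT theta g) =
  cosT (theta + (size w)%:R * (pi / 2))
       (fun x => (2 * pi) ^+ size w * (word_monomial w x * g x)).
Proof.
move=> gS; elim: w => [|i w IH] /=.
  rewrite mul0r addr0; congr cosT; apply/funext => x.
  by rewrite expr0 mul1r /word_monomial big_nil mul1r.
rewrite IH partial_cosT; last exact/rapidZ/rapid_word.
rewrite -addrA -[X in _ * _ + X]mul1r -mulrDl natr1; congr cosT.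
by apply/funext => x; rewrite word_monomial_cons exprS; ring.
Qed.

Lemma is_derive_line g (dg : Rn -> R) x y (s : R) :
  (forall z, is_derive z y g (dg z)) ->
  is_derive s (1:R) (fun t : R => g (x + t *: y)) (dg (x + s *: y)).
Proof.
move=> gd; have [gex gval] := gd (x + s *: y).
have E : (fun h : R => h^-1 *: (((fun t : R => g (x + t *: y)) \o shift s) (h *: (1:R))
            - g (x + s *: y))) =
         (fun h : R => h^-1 *: ((g \o shift (x + s *: y)) (h *: y) - g (x + s *: y))).
  apply/funext => h /=; congr (_ *: (g _ - _)).
  by rewrite /GRing.scale/= mulr1 -/(GRing.scale _ _) scalerDl addrCA.
by apply: DeriveDef; rewrite /derivable /derive E.
Qed.

(** Translations by at most [1] preserve the weight up to a factor, so the
    remainder of a Taylor expansion along such a translation stays dominated. *)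
Lemma weight_shift x i (s : R) : 0 <= s <= 1 ->
  weight (x + s *: e_ i) <= 3 * weight x.
Proof.
move=> /andP[s0 s1]; rewrite /weight (bigD1 i)//= [in leRHS](bigD1 i)//= mulrA.
rewrite !mxE !eqxx mulr1.
rewrite (eq_bigr (fun j => (1 + x 0 j ^+ 2)^-1)); last first.
  by move=> j ji; rewrite !mxE (negbTE ji) andbF mulr0 addr0.
rewrite ler_wpM2r//.
  by apply: prodr_ge0 => j _; rewrite invr_ge0 addr_ge0// sqr_ge0.
have p1 (t : R) : 0 < 1 + t ^+ 2 by rewrite ltr_pwDl// sqr_ge0.
rewrite ler_pdivlMr// mulrC ler_pdivrMr//.
set t := x 0 i.
have : 0 <= (t + s + t + s + s) ^+ 2 by exact: sqr_ge0.
have : s ^+ 2 <= 1 by rewrite expr_le1.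
have : 0 <= (t + s *+ 3) ^+ 2 by exact: sqr_ge0.
have : 0 <= (t *+ 2 + s *+ 3) ^+ 2 by exact: sqr_ge0.
nra.
Qed.

(** By translation invariance, [s] times the integral of [g1] is up to sign the
    integral of the Taylor remainder of [g] for the increment [s], which is of
    order [s ^+ 2]; now divide by [s] and let [s] tend to [0]. *)
Lemma integralRn_derive0 i g (g1 g2 : Rn -> R) :
  (forall x, is_derive x (e_ i) g (g1 x)) ->
  (forall x, is_derive x (e_ i) g1 (g2 x)) ->
  rapid g -> rapid g1 -> rapid g2 -> integralRn g1 = 0.
Proof.
move=> gd g1d gS g1S g2S.
have [C CE] := rapid_weight g2S.
have C0 : 0 <= C.
  have := le_trans (normr_ge0 _) (CE 0); rewrite pmulr_lge0//; exact: weight_gt0.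
set I := integralRn g1.
have small (s : R) : 0 < s -> s <= 1 -> s * `|I| <= (C * 3 * mass (n := n)) * s ^+ 2.
  move=> s0 s1.
  have cg : measurableRn g.
    exact: measurable_continuous_row (rapid_continuous gS).
  have shiftE : integralRn (fun x => g (s *: e_ i + 1 *: x)) = integralRn g.
    by rewrite -(integralRn_affine (s *: e_ i) ltr01 cg) expr1n mul1r.
  have cshift : continuous (fun x => g (s *: e_ i + 1 *: x)).
    move=> x; apply: (@continuous_comp _ _ _ (fun x => s *: e_ i + 1 *: x) g).
      apply: continuousD; first exact: cst_continuous.
      exact: scaler_continuous.
    exact: rapid_continuous.
  have ishift : integrableRn (fun x => g (s *: e_ i + 1 *: x)).
    have [D DE] := rapid_weight gS.
    apply: (@integrableRn_weight _ _ _ (D * 3)) => // x.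
    apply: (le_trans (DE _)); rewrite scale1r addrC -mulrA.
    rewrite ler_wpM2l//.
      have := le_trans (normr_ge0 _) (DE 0); rewrite pmulr_lge0//; exact: weight_gt0.
    by apply: weight_shift; rewrite (ltW s0).
  have ig := rapid_integrable gS; have ig1 := rapid_integrable (rapidZ s g1S).
  have -> : s * `|I| = `|integralRn (fun x => g (s *: e_ i + 1 *: x) - g x - s * g1 x)|.
    rewrite integralRnB//; last exact: integrableRnB.
    rewrite integralRnB// shiftE subrr sub0r normrN integralRnZ//.
      by rewrite normrM gtr0_norm.
    exact: rapid_integrable.
  rewrite mulrAC; apply: norm_integralRn_le.
    by apply: integrableRnB => //; exact: integrableRnB.
  move=> x; rewrite scale1r (addrC (s *: _)).
  have d1 (t : R) := is_derive_line x t gd.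
  have d2 (t : R) := is_derive_line x t g1d.
  have := taylor2_bound (M := C * 3 * weight x) (a := 0) (s := s) d1 d2.
  rewrite /= scale0r addr0 add0r => H; rewrite [leRHS]mulrAC; apply: H => c /andP[c0 c1].
  rewrite add0r; apply: (le_trans (CE _)); rewrite -mulrA ler_wpM2l//.
  by apply: weight_shift; rewrite mulr_ge0 ?(ltW s0)//= mulr_ile1// ltW.
apply/eqP; rewrite -normr_le0; apply/ler_addgt0Pl => e e0; rewrite addr0.
set K := C * 3 * mass (n := n) in small.
have K0 : 0 <= K by rewrite !mulr_ge0// mass_ge0.
pose s := Num.min 1 (e / (K + 1)).
have s0 : 0 < s by rewrite lt_min ltr01 divr_gt0// ltr_wpDl.
have s1 : s <= 1 by rewrite ge_min lexx.
have := small s s0 s1; rewrite expr2 mulrA (mulrC _ s) ler_pM2l// => /le_trans; apply.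
have : s <= e / (K + 1) by rewrite ge_min lexx orbT.
rewrite ler_pdivlMr ?ltr_wpDl// mulrC; apply: le_trans.
by rewrite ler_wpM2r ?(ltW s0)// lerDl.
Qed.

(** Integration by parts: the derivative of [h * wave] has integral [0]. *)
Lemma cosT_partial i theta xi h (h1 h2 : Rn -> R) :
  (forall x, is_derive x (e_ i) h (h1 x)) ->
  (forall x, is_derive x (e_ i) h1 (h2 x)) ->
  rapid h -> rapid h1 -> rapid h2 ->
  2 * pi * xi 0 i * cosT theta h xi = cosT (theta + pi / 2) h1 xi.
Proof.
move=> hd h1d hS h1S h2S.
(* each derivative of a wave adds [pi / 2] to its phase and multiplies it by [b] *)
pose b := 2 * pi * xi 0 i.
pose W (j : nat) := wave (theta + pi / 2 + j%:R * (pi / 2)) xi.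
have Wd j x : is_derive x (e_ i) (W j) (b * W j.+1 x).
  have := is_derive_wave (theta + pi / 2 + j%:R * (pi / 2)) xi (e_ i) x.
  rewrite dotRnC dotRn_delta -/b -[_ + _ + pi / 2]addrA -[X in _ * _ + X]mul1r -mulrDl.
  by rewrite natr1.
have hW j f : rapid f -> rapid (fun x => f x * W j x) by exact: rapid_wave.
have hbW j f : rapid f -> rapid (fun x => f x * (b * W j x)).
  move=> fS; rewrite (_ : (fun _ => _) = fun x => b * (f x * W j x)).
    exact/rapidZ/hW.
  by apply/funext => x; rewrite mulrCA.
have bWd j x : is_derive x (e_ i) (fun x => b * W j x) (b * (b * W j.+1 x)).
  have := is_derive_mulf (is_derive_cst b x (e_ i)) (Wd j x).
  by rewrite mul0r add0r.
have d1 x := is_derive_mulf (hd x) (Wd 0 x).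
have d2 x := is_derive_addf (is_derive_mulf (h1d x) (Wd 0 x)) (is_derive_mulf (hd x) (bWd 1 x)).
have := integralRn_derive0 d1 d2 (hW _ _ hS) (rapidD (hW _ _ h1S) (hbW _ _ hS)).
have -> : integralRn (fun x => h1 x * W 0 x + h x * (b * W 1 x)) =
          cosT (theta + pi / 2) h1 xi - b * cosT theta h xi.
  rewrite /cosT -integralRnZ; last exact/rapid_integrable/rapid_wave.
  rewrite -integralRnB; last 2 first.
  - exact/rapid_integrable/rapid_wave.
  - exact/rapid_integrable/rapidZ/rapid_wave.
  apply: eq_integralRn => x; rewrite /W mul0r addr0; congr (_ + _).
  rewrite mul1r /wave -[theta + _ + _]addrA -splitr addrA cosDpi.
  by rewrite -/b; ring.
move=> /(_ _)/eqP; rewrite subr_eq0 eq_sym => H; apply/eqP/H.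
apply: rapidD.
  by apply: rapidD; [exact: hW|exact: hbW].
apply: rapidD; first exact: hbW.
rewrite (_ : (fun _ => _) = fun x => b * (h x * (b * W 2 x))).
  exact/rapidZ/hbW.
by apply/funext => x; rewrite [RHS]mulrCA.
Qed.

End smoothness.

(** * Words, multi-indices and the Leibniz rule *)

Section words.
Context {R : realType} {n : nat}.
Local Notation Rn := 'rV[R]_n.
Local Notation e_ i := (delta_mx 0 i : Rn).
Implicit Types (g h : Rn -> R) (x xi y : Rn) (u v w d : seq 'I_n) (a b : {ffun 'I_n -> nat}).

Definition leqI (i j : 'I_n) : bool := (i <= j)%N.

Lemma leqI_trans : transitive leqI. Proof. by move=> j i k; exact: leq_trans. Qed.
Lemma leqI_anti : antisymmetric leqI.
Proof. by move=> i j; rewrite /leqI -eqn_leq => /eqP/val_inj. Qed.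
Lemma leqI_total : total leqI. Proof. by move=> i j; exact: leq_total. Qed.

Definition word_of b : seq 'I_n := flatten [seq nseq (b i) i | i <- enum 'I_n].

(** The multi-index of a word; [word_of] inverts it on increasing words. *)
Definition counts v : {ffun 'I_n -> nat} := [ffun i => count_mem i v].

Lemma size_word_of b : size (word_of b) = mindex_size b.
Proof.
rewrite size_flatten /shape -map_comp sumnE big_map big_enum /=.
by apply: eq_bigr => i _; rewrite size_nseq.
Qed.

Lemma count_word_of b i : count_mem i (word_of b) = b i.
Proof.
rewrite count_flatten -map_comp sumnE big_map big_enum /= (bigD1 i)//=.
rewrite count_nseq /= eqxx mul1n big1 ?addn0// => j ji.
by rewrite count_nseq /= (negbTE ji).
Qed.

Lemma sorted_word_of b : sorted leqI (word_of b).
Proof.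
rewrite sorted_pairwise; last exact: leqI_trans.
have : pairwise (fun i j : 'I_n => i < j)%N (enum 'I_n).
  by rewrite -(pairwise_map val ltn) val_enum_ord -sorted_pairwise ?iota_ltn_sorted//; exact: ltn_trans.
rewrite /word_of; elim: (enum 'I_n) => [//|i s IH] /= /andP[/allP his /IH IHs].
rewrite pairwise_cat IHs andbT; apply/andP; split.
  apply/allrelP => j k /nseqP[-> _] /flatten_mapP[l ls /nseqP[-> _]].
  exact/ltnW/his.
by elim: (b i) => //= m ->; rewrite andbT; apply/allP => j /nseqP[-> _]; exact: leqnn.
Qed.

Lemma word_of_counts v : perm_eq v (word_of (counts v)).
Proof. by apply/allP => i _; rewrite /= count_word_of ffunE. Qed.

Lemma sorted_wordE w : sorted leqI w -> w = word_of (counts w).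
Proof.
move=> sw; apply: (sorted_eq leqI_trans leqI_anti) => //.
  exact: sorted_word_of.
exact: word_of_counts.
Qed.

Lemma word_monomial_perm v w x : perm_eq v w ->
  word_monomial v x = word_monomial w x.
Proof. by move=> vw; exact: perm_big. Qed.

Lemma word_monomial_word_of a x : word_monomial (word_of a) x = monomial a x.
Proof.
rewrite /word_monomial /word_of big_flatten big_map big_enum /=.
by apply: eq_bigr => i _; rewrite big_nseq iter_mulr mulr1.
Qed.

Lemma word_partial_cat w d g : word_partial (w ++ d) g = word_partial w (word_partial d g).
Proof. by rewrite /word_partial foldr_cat. Qed.

Lemma word_partial_word_of b g : word_partial (word_of b) g = mpartial b g.
Proof.
rewrite /word_partial /word_of /mpartial; elim: (enum 'I_n) => [//|i s IH] /=.
by rewrite foldr_cat IH; elim: (b i) => //= m ->.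
Qed.

Definition smoothR g := forall k, is_Ck k g.

Lemma smoothR_partial i g : smoothR g -> smoothR (partial i g).
Proof. by move=> gC k; have [_ /(_ i)[]] := gC k.+1. Qed.

Lemma smoothR_word_partial w g : smoothR g -> smoothR (word_partial w g).
Proof. by move=> gC; elim: w => [//|i w IH]; exact: smoothR_partial. Qed.

Lemma smoothR_continuous g : smoothR g -> continuous g.
Proof. by move=> /(_ 0%N)[]. Qed.

Lemma smoothR_is_derive i g x : smoothR g -> is_derive x (e_ i) g (partial i g x).
Proof. by move=> /(_ 1%N)[_ /(_ i)[dg _]]; exact: is_derive_partial. Qed.

Lemma smoothRM g h : smoothR g -> smoothR h -> smoothR (fun x => g x * h x).
Proof. by move=> gC hC k; exact: is_CkM. Qed.

Lemma smoothR_word v : smoothR (word_monomial (R := R) v).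
Proof. by move=> k; exact: is_Ck_word. Qed.

Lemma word_partial_comb w (c : R) g h : smoothR g -> smoothR h ->
  word_partial w (fun x => c * g x + h x) =
  (fun x => c * word_partial w g x + word_partial w h x).
Proof.
move=> gC hC; elim: w => [//|i w IH] /=; rewrite IH; apply: partialE => x.
apply: is_derive_addf; last exact/smoothR_is_derive/smoothR_word_partial.
have := is_derive_mulf (is_derive_cst c x (e_ i))
  (smoothR_is_derive i x (smoothR_word_partial w gC)).
by rewrite mul0r add0r.
Qed.

Lemma is_derive_word v i x : is_derive x (e_ i) (word_monomial (R := R) v)
  ((count_mem i v)%:R * word_monomial (rem i v) x).
Proof.
elim: v => [|j v IH].
  rewrite mul0r (_ : word_monomial _ = fun=> 1); first exact: is_derive_cst.
  by apply/funext => z; rewrite /word_monomial big_nil.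
have -> : word_monomial (j :: v) = fun z : Rn => z 0 j * word_monomial v z.
  by apply/funext => z; rewrite word_monomial_cons.
apply: (is_derive_eq (is_derive_mulf (is_derive_coord i j x) IH)).
rewrite /= eq_sym; case: eqVneq => [->|ji] /=; last first.
  by rewrite word_monomial_cons mul0r !add0r mulrCA.
rewrite mul1r mulrCA -word_monomial_cons add1n -natr1 mulrDl mul1r addrC.
congr (_ + _); have [iv|iv] := boolP (i \in v).
  by congr (_ * _); apply: word_monomial_perm; rewrite perm_sym perm_to_rem.
by rewrite (count_memPn iv) !mul0r.
Qed.

(** One derivative either hits the monomial, which costs at most [size v] and
    shortens it, or is passed on to [g]; iterating from the innermost
    derivative keeps the letters reaching [g] in increasing order, so that no
    exchange of partial derivatives is ever needed. *)
Lemma leibniz_bound g x (B : R) N P : smoothR g ->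
  (forall u d, (size u <= N)%N -> (size d <= P)%N -> sorted leqI d ->
     `|word_monomial u x * word_partial d g x| <= B) ->
  forall w d v u, sorted leqI (w ++ d) -> (size u + size v <= N)%N ->
    (size w + size d <= P)%N ->
  `|word_monomial u x *
     word_partial w (fun z => word_monomial v z * word_partial d g z) x|
  <= (1 + (size v)%:R) ^+ size w * B.
Proof.
move=> gC gB; have B0 : 0 <= B.
  by apply: le_trans (gB [::] [::] _ _ _) => //; exact: normr_ge0.
elim/last_ind => [|w i IH] d v u swd uvN wdP.
  by rewrite expr0 mul1r /= mulrA -word_monomial_cat gB// size_cat.
rewrite -cats1 word_partial_cat /=.
have -> : partial i (fun z => word_monomial v z * word_partial d g z) =
    fun z => (count_mem i v)%:R * (word_monomial (rem i v) z * word_partial d g z)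
             + word_monomial v z * word_partial (i :: d) g z.
  apply: partialE => z.
  apply: (is_derive_eq (is_derive_mulf (is_derive_word v i z)
    (smoothR_is_derive i z (smoothR_word_partial d gC)))).
  by rewrite mulrA.
have sm v' d' : smoothR (fun z => word_monomial v' z * word_partial d' g z).
  by apply: smoothRM; [exact: smoothR_word|exact: smoothR_word_partial].
rewrite word_partial_comb; [|exact: sm|exact: (sm v (i :: d))].
rewrite mulrDr cats1 size_rcons.
move: swd; rewrite cat_rcons => swd.
move: wdP; rewrite size_rcons addSnnS => wdP.
have le_rem : (size (rem i v) <= size v)%N by apply: size_subseq; exact: rem_subseq.
have IH1 : `|word_monomial u x * word_partial w (fun z =>
    word_monomial (rem i v) z * word_partial d g z) x| <= (1 + (size v)%:R) ^+ size w * B.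
  apply: (le_trans (IH d (rem i v) u _ _ _)).
  - apply: (subseq_sorted leqI_trans) swd.
    by apply: cat_subseq => //; exact: subseq_cons.
  - by apply: leq_trans uvN; rewrite leq_add2l.
  - by apply: leq_trans wdP; rewrite leq_add2l leqnSn.
  rewrite ler_wpM2r// lerXn2r ?nnegrE ?addr_ge0//.
  by rewrite lerD2l ler_nat.
have IH2 := IH (i :: d) v u swd uvN wdP.
rewrite exprS -mulrA mulrDl mul1r addrC; apply: (le_trans (ler_normD _ _)).
apply: lerD; first exact: IH2.
rewrite mulrCA normrM normr_nat ler_pM// ler_nat.
exact: count_size.
Qed.

End words.

(** * The weight sequence *)

Section weight_sequence.
Context {R : realType} (sigma : R) (sigma1 : 1 < sigma).
Implicit Types (tau : R) (p q m : nat).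
Local Notation M tau p := (Mseq tau sigma p).

Let sigma0 : 0 <= sigma. Proof. by rewrite ltW// (lt_trans ltr01). Qed.

Lemma Mseq0 tau : M tau 0 = 1. Proof. by rewrite /Mseq eqxx. Qed.

Lemma MseqS tau p : (0 < p)%N -> M tau p = p%:R `^ (tau * p%:R `^ sigma).
Proof. by rewrite /Mseq; case: p. Qed.

Lemma Mseq_mono tau p q : 0 <= tau -> (p <= q)%N -> M tau p <= M tau q.
Proof.
move=> tau0; case: p => [_|p pq].
  rewrite Mseq0; case: q => [|q]; first by rewrite Mseq0.
  rewrite MseqS// -[leLHS](powRr0 q.+1%:R) ler_powR//; first by rewrite ler1n.
  by rewrite mulr_ge0// powR_ge0.
rewrite !MseqS//; last exact: leq_trans pq.
apply: (@le_trans _ _ (p.+1%:R `^ (tau * q%:R `^ sigma))).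
  rewrite ler_powR ?ler1n// ler_wpM2l//.
  by apply: ge0_ler_powR => //; rewrite ?nnegrE ?ler_nat.
by apply: ge0_ler_powR; rewrite ?nnegrE ?ler_nat// mulr_ge0// powR_ge0.
Qed.

Lemma Mseq_ge1 tau p : 0 <= tau -> 1 <= M tau p.
Proof. by move=> tau0; rewrite -(Mseq0 tau) Mseq_mono. Qed.

Lemma Mseq_ge0 tau p : 0 <= M tau p.
Proof. by case: p => [|p]; rewrite ?Mseq0// MseqS// powR_ge0. Qed.

Lemma Mseq_mono_tau tau tau' p : tau <= tau' -> M tau p <= M tau' p.
Proof.
move=> tt; case: p => [|p]; first by rewrite !Mseq0.
by rewrite !MseqS// ler_powR ?ler1n// ler_wpM2r// powR_ge0.
Qed.

Lemma MseqD tau tau' p : M tau p * M tau' p = M (tau + tau') p.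
Proof.
case: p => [|p]; first by rewrite !Mseq0 mul1r.
by rewrite !MseqS// mulrDl powRD// pnatr_eq0 implybT.
Qed.

(** For [q] large, [q + m <= q ^ 2] and [(q + m) ^ sigma <= 2 ^ sigma * q ^ sigma]:
    a shift of the index only multiplies the parameter by a constant. *)
Lemma Mseq_shift tau m : 0 < tau -> exists2 C, 0 < C &
  forall q, M tau (m + q) <= C * M (2 * 2 `^ sigma * tau) q.
Proof.
move=> tau0; have tau0' := ltW tau0.
pose q0 := maxn m 2; exists (M tau (m + q0)).
  by apply: lt_le_trans ltr01 _; exact: Mseq_ge1.
have t2 : 0 <= 2 * 2 `^ sigma * tau by rewrite !mulr_ge0// powR_ge0.
move=> q; have [qq0|q0q] := leqP q q0.
  rewrite -[leLHS]mulr1 ler_pM ?Mseq_ge0 ?Mseq_ge1//.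
  by apply: Mseq_mono => //; rewrite leq_add2l.
rewrite -[leLHS]mul1r ler_pM ?Mseq_ge0 ?Mseq_ge1//.
have mq : (m <= q)%N by apply: leq_trans (leq_maxl _ _) (ltnW q0q).
have q2 : (2 <= q)%N by apply: leq_trans (leq_maxr _ _) (ltnW q0q).
have q1 : (0 < q)%N by exact: leq_trans q2.
rewrite !MseqS ?addn_gt0 ?q1 ?orbT//.
have mq2 : (m + q <= 2 * q)%N by rewrite mul2n -addnn leq_add2r.
have qq : (m + q)%:R <= q%:R `^ 2 :> R.
  rewrite powR_mulrn// -natrX ler_nat (leq_trans mq2)//.
  by rewrite expnS expn1 leq_mul2r q2 orbT.
apply: (@le_trans _ _ ((q%:R `^ 2) `^ (tau * (m + q)%:R `^ sigma))).
  apply: ge0_ler_powR => //; rewrite ?nnegrE ?powR_ge0//.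
  by rewrite mulr_ge0// powR_ge0.
rewrite -powRrM ler_powR ?ler1n//.
rewrite [leRHS](_ : _ = 2 * (tau * (2 * q%:R) `^ sigma)); last first.
  by rewrite powRM//; ring.
rewrite ler_wpM2l// ler_wpM2l//.
apply: ge0_ler_powR => //; rewrite ?nnegrE ?mulr_ge0//.
by rewrite -natrM ler_nat.
Qed.

(** Since [sigma > 1], the exponent [tau * p ^ sigma] eventually exceeds [2 * p]. *)
Lemma Mseq_power tau : 0 < tau -> exists2 C, 0 < C &
  forall p, (1 + p%:R) ^+ p <= C * M tau p.
Proof.
move=> tau0; have tau0' := ltW tau0.
have s1 : 0 < sigma - 1 by rewrite subr_gt0.
(* [r <= p] means that [2 * p <= tau * p ^ sigma] *)
pose r := (2 / tau) `^ (sigma - 1)^-1.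
have r0 : 0 <= r by exact: powR_ge0.
pose p0 := (Num.truncn r + 2)%N.
exists ((1 + p0%:R) ^+ p0); first by rewrite exprn_gt0// ltr_wpDr.
move=> p; have [pp0|p0p] := leqP p p0.
  rewrite -[leLHS]mulr1 ler_pM ?Mseq_ge1 ?exprn_ge0 ?addr_ge0//.
  apply: (@le_trans _ _ ((1 + p0%:R) ^+ p)).
    by rewrite lerXn2r ?nnegrE ?addr_ge0// lerD2l ler_nat.
  by rewrite ler_weXn2l// lerDl.
rewrite -[leLHS]mul1r ler_pM ?exprn_ge0 ?addr_ge0//.
  by rewrite exprn_ege1// lerDl.
have p2 : (2 <= p)%N by apply: leq_trans (leq_addl _ _) (ltnW p0p).
have rp : r <= p%:R.
  have /ltW := truncnS_gt r; move=> /le_trans; apply; rewrite ler_nat.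
  by apply: leq_trans (ltnW p0p); rewrite /p0 addn2.
have p0' : (0 < p)%N by exact: leq_trans p2.
rewrite MseqS// -powR_mulrn ?addr_ge0//.
apply: (@le_trans _ _ ((p%:R `^ 2) `^ p%:R)).
  apply: ge0_ler_powR => //; rewrite ?nnegrE ?powR_ge0 ?addr_ge0//.
  rewrite powR_mulrn// -natrX addrC natr1 ler_nat.
  rewrite expnS expn1; apply: (@leq_trans (2 * p)); last by rewrite leq_mul2r p2 orbT.
  by rewrite mul2n -addnn -addn1 leq_add2l.
rewrite -powRrM ler_powR ?ler1n//.
rewrite -(mulr_powRB1 (x := p%:R)) ?(lt_trans ltr01)// mulrCA mulrC ler_wpM2l//.
rewrite mulrC -ler_pdivrMr//.
have -> : 2 / tau = r `^ (sigma - 1).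
  by rewrite /r -powRrM mulVf ?gt_eqF// powRr1// divr_ge0.
by apply: ge0_ler_powR => //; rewrite ?nnegrE// ltW.
Qed.

(** Geometric growth is dominated by that of [(1 + p) ^ p]. *)
Lemma Mseq_geometric tau (A : R) : 1 <= A -> 0 < tau -> exists2 C, 0 < C &
  forall p, A ^+ p <= C * M tau p.
Proof.
move=> A1 /Mseq_power[C C0 CE].
have A0 : 0 <= A by exact: le_trans A1.
pose p0 := (Num.truncn A).+1; exists (A ^+ p0 * C); first by rewrite mulr_gt0// exprn_gt0// (lt_le_trans ltr01).
move=> p; rewrite -mulrA; apply: (@le_trans _ _ (A ^+ p0 * (1 + p%:R) ^+ p)); last first.
  by rewrite ler_wpM2l// exprn_ge0.
have [pp0|p0p] := leqP p p0.
  rewrite -[leLHS]mulr1 ler_pM ?exprn_ge0//; first by rewrite ler_weXn2l.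
  by rewrite exprn_ege1// lerDl.
rewrite -[leLHS]mul1r ler_pM ?exprn_ge0//; first by rewrite exprn_ege1.
rewrite lerXn2r ?nnegrE ?addr_ge0//.
have /ltW/le_trans -> // := truncnS_gt A.
by rewrite addrC natr1 ler_nat ltnW// ltnS ltnW.
Qed.

(** With [m] the larger of [p] and [q], the left side is at most [(1 + m) ^ m]. *)
Lemma Mseq_mixed tau : 0 < tau -> exists2 C, 0 < C &
  forall p q, (1 + q%:R) ^+ p <= C * (M tau p * M tau q).
Proof.
move=> tau0; have tau0' := ltW tau0; have [C C0 CE] := Mseq_power tau0; exists C => // p q.
have [pq|qp] := leqP p q.
  apply: (@le_trans _ _ ((1 + q%:R) ^+ q)); first by rewrite ler_weXn2l// lerDl.
  apply: (le_trans (CE q)); rewrite ler_wpM2l ?(ltW C0)//.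
  by rewrite -[leLHS]mul1r ler_wpM2r ?Mseq_ge0 ?Mseq_ge1.
apply: (@le_trans _ _ ((1 + p%:R) ^+ p)).
  by rewrite lerXn2r ?nnegrE ?addr_ge0// lerD2l ler_nat ltnW.
apply: (le_trans (CE p)); rewrite ler_wpM2l ?(ltW C0)//.
by rewrite -[leLHS]mulr1 ler_wpM2l ?Mseq_ge0 ?Mseq_ge1.
Qed.

(** The factor lost on [tau]: [2 * 2 `^ sigma] comes from the shift of the index,
    and [2] from the powers and from the factor [Mseq tau sigma p] itself. *)
Definition Mloss : R := 2 * 2 `^ sigma + 2.

Lemma Mloss_gt0 : 0 < Mloss.
Proof. by rewrite ltr_wpDl// mulr_ge0// powR_ge0. Qed.

Lemma Mseq_absorb tau m : 0 < tau -> exists2 C, 0 < C & forall p q,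
  (2 * pi) ^+ q * ((1 + q%:R) ^+ p * (M tau (m + q) * M tau p)) <=
  C * M (Mloss * tau) p * M (Mloss * tau) q.
Proof.
move=> tau0; have tau0' := ltW tau0.
have [C1 C10 C1E] : exists2 C, 0 < C & forall p, (2 * pi) ^+ p <= C * M tau p.
  by apply: Mseq_geometric => //; have := @pi_ge2 R; lra.
have [C2 C20 C2E] := Mseq_mixed tau0.
have [C3 C30 C3E] := Mseq_shift m tau0.
exists (C1 * (C2 * C3)); first by rewrite !mulr_gt0.
move=> p q; apply: (@le_trans _ _ ((C1 * M tau q) * ((C2 * (M tau p * M tau q)) *
    ((C3 * M (2 * 2 `^ sigma * tau) q) * M tau p)))).
  rewrite ler_pM ?exprn_ge0 ?mulr_ge0 ?pi_ge0 ?exprn_ge0 ?addr_ge0 ?Mseq_ge0//.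
  rewrite ler_pM ?exprn_ge0 ?mulr_ge0 ?addr_ge0 ?Mseq_ge0//.
  by rewrite ler_wpM2r// Mseq_ge0.
rewrite [leLHS](_ : _ = C1 * (C2 * C3) * (M tau p * M tau p) *
  (M (2 * 2 `^ sigma * tau) q * (M tau q * M tau q))); last by ring.
rewrite !MseqD -!mulrA !ler_wpM2l ?(ltW C10) ?(ltW C20) ?(ltW C30)//.
rewrite ler_pM ?Mseq_ge0 ?mulrA//.
  apply: Mseq_mono_tau; rewrite -mulr2n -mulr_natl ler_wpM2r// lerDr.
  by rewrite mulr_ge0// powR_ge0.
rewrite (_ : Mloss * tau = 2 * 2 `^ sigma * tau + (tau + tau))//.
by rewrite /Mloss; ring.
Qed.

End weight_sequence.

(** * Stability of the estimates under the transform *)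

Section stability.
Context {R : realType} {n : nat} (sigma : R) (sigma1 : 1 < sigma).
Local Notation Rn := 'rV[R]_n.
Implicit Types (g h : Rn -> R) (x xi y : Rn) (u v w d : seq 'I_n) (tau c : R).
Local Notation M tau p := (Mseq tau sigma p).

(** The estimate defining the Gelfand-Shilov spaces, for a real function and in
    terms of words. *)
Definition controlled tau c g := forall v w, sorted (@leqI n) w -> forall x,
  `|word_monomial v x * word_partial w g x| <= c * M tau (size v) * M tau (size w).

Lemma controlled_ge0 tau c g : 0 <= tau -> controlled tau c g -> 0 <= c.
Proof.
move=> tau0 /(_ [::] [::] isT 0); rewrite !Mseq0 !mulr1.
by apply: le_trans; exact: normr_ge0.
Qed.

Lemma controlled_leibniz tau c g u v w x : 0 <= tau -> smoothR g ->
  controlled tau c g -> sorted (@leqI n) w ->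
  `|word_monomial u x * word_partial w (fun z => word_monomial v z * g z) x| <=
  (1 + (size v)%:R) ^+ size w * (c * M tau (size u + size v) * M tau (size w)).
Proof.
move=> tau0 gC gc sw; have c0 := controlled_ge0 tau0 gc.
apply: (@leibniz_bound _ _ g x _ (size u + size v) (size w) gC _ w [::]) => //.
- move=> u' d su sd sd'; apply: (le_trans (gc _ _ sd' x)).
  rewrite ler_pM ?mulr_ge0 ?Mseq_ge0//; last exact: Mseq_mono.
  by rewrite ler_wpM2l// Mseq_mono.
- by rewrite cats0.
- by rewrite addn0.
Qed.

Lemma controlled_rapid tau c g v w : 0 <= tau -> smoothR g ->
  controlled tau c g -> sorted (@leqI n) w ->
  rapid (word_partial w (fun z => word_monomial v z * g z)).
Proof.
move=> tau0 gC gc sw; split.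
  apply/smoothR_continuous/smoothR_word_partial/smoothRM => //.
  exact: smoothR_word.
by move=> u; eexists => x; exact: (controlled_leibniz u v x tau0 gC gc sw).
Qed.

Lemma controlled_rapid0 tau c g : 0 <= tau -> smoothR g -> controlled tau c g -> rapid g.
Proof.
move=> tau0 gC gc; have := @controlled_rapid tau c g [::] [::] tau0 gC gc isT.
rewrite (_ : word_partial _ _ = g)//; apply/funext => x.
by rewrite /= /word_monomial big_nil mul1r.
Qed.

(** Letters are moved from the monomial to a derivative by [cosT_partial], the
    last one first, so that all intermediate words are increasing. *)
Lemma word_monomial_cosT v theta g xi : sorted (@leqI n) v -> smoothR g ->
  (forall w, sorted (@leqI n) w -> rapid (word_partial w g)) ->
  (2 * pi) ^+ size v * word_monomial v xi * cosT theta g xi =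
  cosT (theta + (size v)%:R * (pi / 2)) (word_partial v g) xi.
Proof.
move=> + gC gS; elim: v => [_|i v IH iv].
  by rewrite expr0 mul1r /word_monomial big_nil mul1r mul0r addr0.
have sv : sorted (@leqI n) v by exact: path_sorted iv.
have iiv : sorted (@leqI n) [:: i, i & v] by rewrite /= /leqI leqnn.
have gD w x := smoothR_is_derive i x (smoothR_word_partial w gC).
have := cosT_partial (theta + (size v)%:R * (pi / 2)) xi (gD v) (gD (i :: v))
  (gS _ sv) (gS _ iv) (gS _ iiv).
rewrite -(IH sv) -addrA -[X in _ * _ + X]mul1r -mulrDl natr1 => <-.
by rewrite word_monomial_cons /= exprS; ring.
Qed.

(** Derivatives of the transform become the monomial [w] inside it; the monomial
    [v] outside, sorted beforehand, becomes the derivative [v'] inside.  The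
    Leibniz bound for monomials [u] of degree at most [2 * n] then controls the
    integral, and [Mseq_absorb] restores the form of the estimate. *)
Lemma controlled_cosT tau c g : 0 < tau -> smoothR g -> controlled tau c g ->
  exists2 C, 0 < C & forall theta, controlled (Mloss sigma * tau) C (cosT theta g).
Proof.
move=> tau0 gC gc; have tau0' := ltW tau0; have c0 := controlled_ge0 tau0' gc.
have [C C0 CE] := Mseq_absorb sigma1 (2 * n) tau0.
pose K := 2 ^+ n * c * mass (R := R) (n := n).
have K0 : 0 <= K by rewrite !mulr_ge0// ?mass_ge0// exprn_ge0.
exists ((K + 1) * C); first by rewrite mulr_gt0// ltr_wpDl.
move=> theta v w sw xi.
have gS := controlled_rapid0 tau0' gC gc.
rewrite word_partial_cosT// cosTZ; last exact: rapid_word.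
set theta' := theta + _; set G := fun x => word_monomial w x * g x.
pose v' := sort (@leqI n) v.
have sv : sorted (@leqI n) v' by apply: sort_sorted; exact: leqI_total.
have sizev : size v' = size v by rewrite size_sort.
have GC : smoothR G by apply: smoothRM => //; exact: smoothR_word.
have GS w' : sorted (@leqI n) w' -> rapid (word_partial w' G).
  exact: controlled_rapid tau0' gC gc.
have := word_monomial_cosT theta' xi sv GC GS.
have vv' : perm_eq v' v by rewrite perm_sort.
rewrite (word_monomial_perm xi vv') sizev => cosE.
have pi1 : 1 <= 2 * pi :> R by have := @pi_ge2 R; lra.
have pi0 : 0 <= 2 * pi :> R by exact: le_trans pi1.
set B := (1 + (size w)%:R) ^+ size v * (c * M tau (2 * n + size w) * M tau (size v)).
have B0 : 0 <= B by rewrite !mulr_ge0 ?exprn_ge0 ?addr_ge0 ?Mseq_ge0.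
have GB x : `|word_partial v' G x| <= 2 ^+ n * B * weight x.
  apply: weight_bound => u su.
  apply: (le_trans (controlled_leibniz u w x tau0' gC gc sv)).
  rewrite sizev ler_wpM2l ?exprn_ge0 ?addr_ge0// ler_wpM2r ?Mseq_ge0//.
  by rewrite ler_wpM2l// Mseq_mono// leq_add2r.
have : `|(2 * pi) ^+ size v * word_monomial v xi * cosT theta' G xi| <= 2 ^+ n * B * mass (n := n).
  by rewrite cosE; apply: cosT_bound => //; exact: GS.
rewrite -mulrA normrM ger0_norm ?exprn_ge0// => bound.
rewrite mulrCA normrM ger0_norm ?exprn_ge0//.
apply: (@le_trans _ _ ((2 * pi) ^+ size w * (2 ^+ n * B * mass (n := n)))).
  rewrite ler_wpM2l ?exprn_ge0//; apply: le_trans bound.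
  by rewrite ler_peMl// exprn_ege1.
rewrite [leLHS](_ : _ = K * ((2 * pi) ^+ size w * ((1 + (size w)%:R) ^+ size v *
    (M tau (2 * n + size w) * M tau (size v))))); last by rewrite /K /B; ring.
rewrite -(mulrA (K + 1)) -(mulrA (K + 1)) ler_pM ?lerDl//.
by rewrite !mulr_ge0 ?exprn_ge0 ?addr_ge0 ?Mseq_ge0.
Qed.

End stability.

(** * The Gaussian and its transform *)

Section gaussian.
Context {R : realType} {n : nat}.
Local Notation Rn := 'rV[R]_n.
Local Notation e_ i := (delta_mx 0 i : Rn).
Local Notation mR := (measurableTypeR R).
Implicit Types (g h : Rn -> R) (x xi y : Rn).

Definition gauss x : R := expR (- (pi * dotRn x x)).

Lemma dotRn_ge0 x : 0 <= dotRn x x.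
Proof. by apply: sumr_ge0 => i _; rewrite -expr2 sqr_ge0. Qed.

Lemma continuous_dotRn_diag : continuous (fun x => dotRn x x).
Proof. by apply: continuous_sumr => i; apply: continuous_mulf; exact: continuous_coord. Qed.

Lemma continuous_gauss : continuous gauss.
Proof.
apply: (@continuous_compf _ _ expR); first exact: continuous_expR.
rewrite (_ : (fun _ => _) = fun x => - pi * dotRn x x).
  by apply: continuous_mulf; [exact: cst_continuous|exact: continuous_dotRn_diag].
by apply/funext => x; rewrite mulNr.
Qed.

Lemma le_sqr_le_add1 (a b : R) : a ^+ 2 <= b -> a <= 1 + b.
Proof. by move=> ab; have := sqr_ge0 (a - 1); have := sqr_ge0 a; nra. Qed.

(** Each letter of [v] is absorbed by half of the exponent that is left. *)
Lemma gauss_decay (v : seq 'I_n) (c : R) : 0 < c ->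
  exists C, forall x, `|word_monomial v x| * expR (- (c * dotRn x x)) <= C.
Proof.
elim: v c => [|i v IH] c c0.
  exists 1 => x; rewrite /word_monomial big_nil normr1 mul1r -expR0 ler_expR.
  by rewrite oppr_le0 mulr_ge0 ?dotRn_ge0// ltW.
have c2 : 0 < c / 2 by rewrite divr_gt0.
have [C CE] := IH _ c2; exists ((1 + 2 / c) * C) => x.
set r := dotRn x x; have r0 : 0 <= r := dotRn_ge0 x.
rewrite word_monomial_cons normrM.
have -> : expR (- (c * r)) = expR (- (c / 2 * r)) * expR (- (c / 2 * r)).
  by rewrite -expRD; congr expR; field.
rewrite mulrACA; apply: ler_pM; rewrite ?mulr_ge0 ?expR_ge0 ?normr_ge0//.
rewrite expRN ler_pdivrMr ?expR_gt0//.
have xr : `|x 0 i| <= 1 + r.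
  have : x 0 i ^+ 2 <= r.
    rewrite /r /dotRn (bigD1 i)//= -expr2 lerDl sumr_ge0// => j _.
    by rewrite -expr2 sqr_ge0.
  by rewrite -(real_normK (num_real (x 0 i))); exact: le_sqr_le_add1.
apply: (le_trans xr).
have e1 : 1 + c / 2 * r <= expR (c / 2 * r) by exact: expR_ge1Dx.
apply: (@le_trans _ _ ((1 + 2 / c) * (1 + c / 2 * r))).
  have -> : (1 + 2 / c) * (1 + c / 2 * r) = 1 + r + (c / 2 * r + 2 / c).
    by field; rewrite gt_eqF.
  by rewrite lerDl; apply: addr_ge0; [apply: mulr_ge0 => //; exact: ltW|apply: divr_ge0 => //; exact: ltW].
by rewrite ler_wpM2l// addr_ge0// divr_ge0// ltW.
Qed.

Lemma rapid_gauss : rapid gauss.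
Proof.
split=> [|v]; first exact: continuous_gauss.
have [C CE] := gauss_decay v (@pi_gt0 R); exists C => x.
by rewrite normrM [`|gauss x|]ger0_norm ?expR_ge0.
Qed.

Lemma integral_gauss1 : (\int[@lebesgue_measure R]_t (expR (- (pi * t ^+ 2)))%:E = 1)%E.
Proof.
pose s : R := Num.sqrt pi; have s0 : 0 < s by rewrite sqrtr_gt0 pi_gt0.
have mg : measurable_fun [set: mR] (fun t => (gauss_fun t)%:E : \bar R).
  by apply/measurable_EFinP; exact: measurable_gauss_fun.
have := ge0_integral_affine 0 s0 mg (fun t => expR_ge0 _).
rewrite integralT_gauss.
under eq_integral => t _.
  rewrite /gauss_fun add0r exprMn sqr_sqrtr ?pi_ge0//.
  over.
set I := (\int[_]_t _)%E => sI.
have : I \is a fin_num.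
  by case: I sI => //=; rewrite ?gt0_muley ?gt0_muleNy ?lte_fin.
move=> /fineK I'; move: sI; rewrite -I' -EFinM => -[] sI.
by congr EFin; apply: (mulfI (lt0r_neq0 s0)); rewrite mulr1.
Qed.

Lemma integralRn_gauss : integralRn gauss = 1.
Proof.
rewrite /integralRn /Rintegral.
under eq_integral => t _.
  rewrite (_ : gauss _ = \prod_(i < n) expR (- (pi * tnth t i ^+ 2))); last first.
    rewrite -expR_sum /gauss; congr expR; rewrite mulr_sumr -sumrN.
    by apply: eq_bigr => i _; rewrite !mxE expr2.
  over.
rewrite (@ge0_integral_tuple_prod R n (fun t => expR (- (pi * t ^+ 2)))).
- by rewrite integral_gauss1 -EFin_expe expr1n.
- apply: continuous_measurable_fun => t.
  apply: (@continuous_comp _ _ _ (fun t : R => - (pi * t ^+ 2)) expR); last exact: continuous_expR.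
  apply: continuousN; apply: continuousM; first exact: cst_continuous.
  exact: exprn_continuous.
- by move=> t; exact: expR_ge0.
Qed.

Lemma is_derive_ray g x y d : is_derive x y g d ->
  is_derive (0:R) (1:R) (fun h : R => g (h *: y + x)) d.
Proof.
move=> [gex gval].
have E : (fun h : R => h^-1 *: (((fun t : R => g (t *: y + x)) \o shift 0) (h *: (1:R))
            - g (0 *: y + x))) =
         (fun h : R => h^-1 *: ((g \o shift x) (h *: y) - g x)).
  apply/funext => h /=.
  by rewrite [h *: 1]mulr1 addr0 scale0r add0r.
by apply: DeriveDef; rewrite /derivable /derive E.
Qed.

Lemma is_derive_ray_inv g x y d : is_derive (0:R) (1:R) (fun h : R => g (h *: y + x)) d ->
  is_derive x y g d.
Proof.
move=> [gex gval].
have E : (fun h : R => h^-1 *: (((fun t : R => g (t *: y + x)) \o shift 0) (h *: (1:R))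
            - g (0 *: y + x))) =
         (fun h : R => h^-1 *: ((g \o shift x) (h *: y) - g x)).
  apply/funext => h /=.
  by rewrite [h *: 1]mulr1 addr0 scale0r add0r.
by move: gex gval; rewrite /derivable /derive E => gex gval; exact: DeriveDef.
Qed.

(** The chain rule, by restriction to a ray. *)
Lemma is_derive_compR (f : R -> R) (df : R) g x y d :
  is_derive (g x) (1:R) f df -> is_derive x y g d ->
  is_derive x y (fun z => f (g z)) (df * d).
Proof.
move=> fd gd; apply: is_derive_ray_inv.
have gd' := is_derive_ray gd.
have fd' : is_derive ((fun h : R => g (h *: y + x)) 0) (1:R) f df.
  by rewrite scale0r add0r.
exact: (is_derive1_comp fd' gd').
Qed.

Lemma is_derive_gauss x y : is_derive x y gauss (- (2 * pi) * dotRn x y * gauss x).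
Proof.
have dd : is_derive x y (fun z : Rn => dotRn z z) (2 * dotRn x y).
  apply: (@is_derive_quadratic _ _ _ _ _ _ (dotRn y y)) => s.
  rewrite !dotRnDl !dotRnDr !dotRnZl !dotRnZr (dotRnC y x).
  rewrite (_ : _ - _ = dotRn y y * s ^+ 2); last by ring.
  by rewrite ger0_norm// mulr_ge0 ?dotRn_ge0 ?sqr_ge0.
have de : is_derive (dotRn x x) (1:R) (fun t : R => expR (- pi * t)) (- pi * gauss x).
  have dm : is_derive (dotRn x x) (1:R) (fun t : R => - pi * t) (- pi).
    have -> : (fun t : R => - pi * t) = (- pi) \*: @id R by apply/funext.
    by apply: is_derive_eq; rewrite scaler1.
  have := is_derive1_comp (is_derive_expR _) dm.
  by rewrite mulrC /gauss -mulNr.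
have := @is_derive_compR (fun t => expR (- pi * t)) _ (fun z => dotRn z z) x y _ de dd.
have -> : (fun z => expR (- pi * dotRn z z)) = gauss by apply/funext => z; rewrite mulNr.
by move=> /is_derive_eq; apply; ring.
Qed.

(** The gradient of the Gaussian is [- (2 * pi)] times [x] times the Gaussian, so
    that integration by parts gives the gradient of its transform. *)
Lemma cosT_gauss_coord i theta xi :
  2 * pi * cosT (theta + pi / 2) (fun x => x 0 i * gauss x) xi =
  - (2 * pi) * xi 0 i * cosT theta gauss xi.
Proof.
have xS := rapid_coord i rapid_gauss; have xxS := rapid_coord i xS.
have d1 x : is_derive x (e_ i) gauss (- (2 * pi) * (x 0 i * gauss x)).
  by have := is_derive_gauss x (e_ i); rewrite dotRn_delta mulrA.
have dx x : is_derive x (e_ i) (fun x => x 0 i * gauss x)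
    (gauss x + - (2 * pi) * (x 0 i * (x 0 i * gauss x))).
  have xd : is_derive x (e_ i) (fun z : Rn => z 0 i) 1.
    by have := is_derive_coord i i x; rewrite eqxx.
  by apply: (is_derive_eq (is_derive_mulf xd (d1 x))); rewrite mul1r mulrCA.
have d2 x : is_derive x (e_ i) (fun x => - (2 * pi) * (x 0 i * gauss x))
    (- (2 * pi) * (gauss x + - (2 * pi) * (x 0 i * (x 0 i * gauss x)))).
  have := is_derive_mulf (is_derive_cst (- (2 * pi)) x (e_ i)) (dx x).
  by rewrite mul0r add0r.
have := cosT_partial theta xi d1 d2 rapid_gauss (rapidZ _ xS)
  (rapidZ _ (rapidD rapid_gauss (rapidZ _ xxS))).
by rewrite cosTZ// !mulNr => ->; rewrite opprK.
Qed.

Lemma cosT_dot theta y g xi : rapid g ->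
  cosT theta (fun x => dotRn x y * g x) xi =
  \sum_i y 0 i * cosT theta (fun x => x 0 i * g x) xi.
Proof.
move=> gS; have yS i : rapid (fun x => y 0 i * (x 0 i * g x)) by exact/rapidZ/rapid_coord.
rewrite (_ : (fun x => dotRn x y * g x) = fun x => \sum_i y 0 i * (x 0 i * g x)); last first.
  by apply/funext => x; rewrite mulr_suml; apply: eq_bigr => i _; rewrite mulrCA mulrA.
elim: (index_enum _) => [|i s IH].
  rewrite big_nil -[RHS](mul0r (cosT theta g xi)) -cosTZ//; congr cosT.
  by apply/funext => x; rewrite big_nil mul0r.
rewrite big_cons -IH -cosTZ; last exact: rapid_coord.
rewrite -cosTD//; last exact: rapid_sum.
by congr cosT; apply/funext => x; rewrite big_cons.
Qed.

(** Along the ray through [xi] the transform solves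
    [phi' s = - 2 pi s |xi|^2 phi s], so [phi s * exp (pi s^2 |xi|^2)] is constant. *)
Lemma cosT_gauss theta xi : cosT theta gauss xi = cos theta * gauss xi.
Proof.
pose phi (s : R) := cosT theta gauss (0 + s *: xi).
have phid (s : R) : is_derive s (1:R) phi (- (2 * pi) * s * dotRn xi xi * phi s).
  have d z := is_derive_cosT theta z xi rapid_gauss.
  apply: (is_derive_eq (is_derive_line 0 s d)).
  rewrite /phi add0r; set eta := s *: xi.
  rewrite cosT_dot; last exact: rapid_gauss.
  transitivity (\sum_i xi 0 i * (- (2 * pi) * eta 0 i * cosT theta gauss eta)).
    by rewrite mulr_sumr; apply: eq_bigr => i _; rewrite mulrCA cosT_gauss_coord.
  rewrite mulr_sumr mulr_suml; apply: eq_bigr => i _; rewrite mxE; ring.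
pose psi (s : R) := phi s * expR (pi * dotRn xi xi * s ^+ 2).
have psid (s : R) : is_derive s (1:R) psi 0.
  have dq : is_derive s (1:R) (fun t : R => pi * dotRn xi xi * t ^+ 2)
      (pi * dotRn xi xi * (2 * s)).
    have -> : (fun t : R => pi * dotRn xi xi * t ^+ 2) = (pi * dotRn xi xi) \*: (@id R ^+ 2).
      by apply/funext.
    by apply: is_derive_eq; rewrite /GRing.scale/= mulr1 expr1.
  have de := @is_derive1_comp R expR (fun t => pi * dotRn xi xi * t ^+ 2) s _ _
    (is_derive_expR _) dq.
  have dphi := phid s.
  have := is_deriveM dphi de.
  by move=> /is_derive_eq; apply; rewrite /GRing.scale/=; ring.
have := is_derive_0_is_cst 1 0 psid.
rewrite /psi /phi scale1r scale0r !add0r expr1n mulr1 expr0n/= mulr0 expR0 mulr1.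
have -> : cosT theta gauss 0 = cos theta.
  rewrite -[RHS]mulr1 -integralRn_gauss -integralRnZ; last exact/rapid_integrable/rapid_gauss.
  apply: eq_integralRn => x; rewrite /wave.
  rewrite (_ : dotRn x 0 = 0) ?mulr0 ?add0r 1?mulrC//.
  by rewrite /dotRn big1// => i _; rewrite mxE mulr0.
by move=> <-; rewrite -mulrA /gauss -expRD subrr expR0 mulr1.
Qed.

End gaussian.

(** * Fourier inversion *)

Section inversion.
Context {R : realType} {n : nat}.
Local Notation Rn := 'rV[R]_n.
Local Notation mR := (measurableTypeR R).
Local Notation rot := (@row_of_tuple R n).
Local Notation mu := (lebesgue_tuple R n).
Implicit Types (f g h u : Rn -> R) (x xi y : Rn).

Lemma integrableRn_fin_num g : integrableRn g ->
  (\int[mu]_t (g (rot t))%:E = (integralRn g)%:E)%E.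
Proof. by move=> ig; rewrite /integralRn /Rintegral fineK//; exact: integrable_fin_num ig. Qed.

Lemma integralRn_cvg (f_ : nat -> Rn -> R) f h :
  (forall k, continuous (f_ k)) -> continuous f ->
  (forall x, f_ k x @[k --> \oo] --> f x) -> integrableRn h ->
  (forall k x, `|f_ k x| <= h x) ->
  integralRn (f_ k) @[k --> \oo] --> integralRn f.
Proof.
move=> cf_ cf f_f ih f_h.
have mE g : continuous g -> measurable_fun [set: n.-tuple mR] (fun t => (g (rot t))%:E).
  by move=> cg; apply/measurable_EFinP; exact: measurable_continuous_row.
have f_E : {ae mu, forall t, [set: n.-tuple mR] t ->
    (f_ k (rot t))%:E @[k --> \oo] --> (f (rot t))%:E}.
  by apply: aeW => t _; apply: cvg_EFin; [exact: nearW|exact: f_f].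
have f_hE : {ae mu, forall t k, [set: n.-tuple mR] t -> (`|(f_ k (rot t))%:E| <= (h (rot t))%:E)%E}.
  by apply: aeW => t k _; rewrite lee_fin.
have [if_ _ cvgf] := dominated_convergence measurableT (fun k => mE _ (cf_ k)) (mE _ cf) f_E ih f_hE.
rewrite (integrableRn_fin_num if_) in cvgf.
exact: fine_cvg cvgf.
Qed.

Lemma integralRn_fubini (F : Rn -> Rn -> R) g h :
  measurable_fun [set: n.-tuple mR * n.-tuple mR] (fun p => F (rot p.1) (rot p.2)) ->
  integrableRn g -> integrableRn h -> (forall x y, `|F x y| <= g x * h y) ->
  integralRn (fun x => integralRn (F x)) = integralRn (fun y => integralRn (F ^~ y)).
Proof.
move=> mF ig ih FB.
pose FE (p : n.-tuple mR * n.-tuple mR) := (F (rot p.1) (rot p.2))%:E.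
have mFE : measurable_fun [set: n.-tuple mR * n.-tuple mR] FE by exact/measurable_EFinP.
have m1 t : measurable_fun [set: n.-tuple mR] (fun s => F (rot t) (rot s)).
  exact: (measurableT_comp mF (pair1_measurable t)).
have m2 s : measurable_fun [set: n.-tuple mR] (fun t => F (rot t) (rot s)).
  exact: (measurableT_comp mF (pair2_measurable s)).
have i1 t : integrableRn (F (rot t)).
  apply: le_integrable (integrableRnZ (g (rot t)) ih) => //.
    apply/measurable_EFinP; exact: m1.
  by move=> s _; rewrite /= lee_fin (le_trans (FB _ _))// ler_norm.
have i2 s : integrableRn (F ^~ (rot s)).
  apply: le_integrable (integrableRnZ (h (rot s)) ig) => //.
    apply/measurable_EFinP; exact: m2.
  by move=> t _; rewrite /= lee_fin mulrC (le_trans (FB _ _))// ler_norm.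
have iFE : (mu \x mu)%E.-integrable [set: n.-tuple mR * n.-tuple mR] FE.
  apply/(integrable12ltyP mu mu mFE).
  have igN : integrableRn (fun x => `|g x|) := @integrable_norm _ _ _ _ _ (g \o rot) ig.
  have ihN : integrableRn (fun x => `|h x|) := @integrable_norm _ _ _ _ _ (h \o rot) ih.
  have igH := integrableRnZ (integralRn (fun y => `|h y|)) igN.
  apply: (@le_lt_trans _ _ (\int[mu]_t (integralRn (fun y => `|h y|) * `|g (rot t)|)%:E)%E); last first.
    by rewrite (integrableRn_fin_num igH) ltry.
  apply: ge0_le_integral => //.
  - by move=> t _; apply: integral_ge0 => s _; exact: abse_ge0.
  - exact: (measurable_fun_fubini_tonelli_F _ (measurableT_comp (@abse_measurable R setT) mFE) (fun p => abse_ge0 _)).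
  - by case/integrableP: igH.
  - move=> t _; rewrite mulrC -integralRnZ// -(integrableRn_fin_num (integrableRnZ _ ihN)).
    apply: ge0_le_integral => //.
    + apply: (measurableT_comp (@abse_measurable R setT)).
      by apply/measurable_EFinP; exact: m1.
    + by case/integrableP: (integrableRnZ (`|g (rot t)|) ihN).
    + move=> s _; rewrite lee_fin; apply: (le_trans (FB _ _)).
      by rewrite -normrM ler_norm.
rewrite /integralRn /Rintegral; congr fine.
transitivity (\int[mu]_t \int[mu]_s FE (t, s))%E.
  by apply: eq_integral => t _; rewrite -(integrableRn_fin_num (i1 t)).
rewrite Fubini//.
by apply: eq_integral => s _; rewrite -(integrableRn_fin_num (i2 s)).
Qed.

Lemma gauss_le1 x : gauss x <= 1.
Proof. by rewrite -expR0 ler_expR oppr_le0 mulr_ge0 ?pi_ge0 ?dotRn_ge0. Qed.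

Lemma gauss0 : gauss (0 : Rn) = 1.
Proof.
rewrite /gauss (_ : dotRn _ _ = 0) ?mulr0 ?oppr0 ?expR0//.
by apply: big1 => i _; rewrite mxE mulr0.
Qed.

Lemma continuous_affine (a : Rn) (e : R) g : continuous g ->
  continuous (fun x => g (a + e *: x)).
Proof.
move=> cg x; apply: (@continuous_comp _ _ _ (fun x => a + e *: x) g); last exact: cg.
by apply: continuousD; [exact: cst_continuous|exact: scaler_continuous].
Qed.

Lemma rapid_gauss_scale (e : R) : 0 < e -> rapid (fun x => gauss (e *: x)).
Proof.
move=> e0; split=> [|v].
  have := @continuous_affine 0 e _ (@continuous_gauss R n).
  by under eq_fun do rewrite add0r.
have [|C CE] := @gauss_decay R n v (pi * e ^+ 2); first by rewrite mulr_gt0 ?pi_gt0 ?exprn_gt0.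
exists C => x; rewrite normrM [X in _ * X]ger0_norm ?expR_ge0//.
by rewrite /gauss dotRnZl dotRnZr [e * _]mulrA -expr2 mulrA.
Qed.

Lemma cosT_gauss_scale theta (e : R) xi : 0 < e ->
  e ^+ n * cosT theta (fun x => gauss (e *: x)) xi = cos theta * gauss (e^-1 *: xi).
Proof.
move=> e0; rewrite -cosT_gauss /cosT.
rewrite -[RHS](integralRn_affine 0 e0); last first.
  apply: measurable_continuous_row; apply: continuous_mulf; first exact: continuous_gauss.
  exact: continuous_wave.
congr (_ * _); apply: eq_integralRn => x; rewrite add0r; congr (_ * cos (_ * _ + _)).
by rewrite dotRnZl dotRnZr mulrA mulfV ?gt_eqF// mul1r.
Qed.

Lemma waveM theta eta x y xi :
  wave theta xi x * wave eta y xi =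
  2^-1 * (wave (theta + eta) (x + y) xi + wave (theta - eta) (x - y) xi).
Proof.
rewrite /wave (dotRnC x) !dotRnDr.
have -> : dotRn xi (- y) = - dotRn xi y.
  by rewrite -scaleN1r dotRnZr mulN1r.
set a := 2 * pi * dotRn xi x + theta; set b := 2 * pi * dotRn xi y + eta.
rewrite (_ : 2 * pi * (_ + _) + _ = a + b); last by rewrite /a /b; ring.
rewrite (_ : 2 * pi * (_ - _) + _ = a - b); last by rewrite /a /b; ring.
by rewrite (cosB a b) (cosD a b); field.
Qed.

(** The mean of [u] against the Gaussian of width [e] centred at [z], in the form
    where the Gaussian does not depend on [e]: this is what dominated convergence
    needs. *)
Definition gauss_mean (e : R) u z : R := integralRn (fun x => u (z + e *: x) * gauss x).

Lemma integralRn_gauss_kernel (e : R) u z : 0 < e -> continuous u ->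
  integralRn (fun x => u x * gauss (e^-1 *: (x - z))) = e ^+ n * gauss_mean e u z.
Proof.
move=> e0 cu; rewrite -[LHS](integralRn_affine z e0); last first.
  apply: measurable_continuous_row; apply: continuous_mulf => //.
  rewrite (_ : (fun _ => _) = fun x => gauss (- e^-1 *: z + e^-1 *: x)).
    by apply: continuous_affine; exact: continuous_gauss.
  by apply/funext => x; rewrite scalerBr scaleNr addrC.
congr (_ * _); apply: eq_integralRn => x; congr (_ * gauss _).
by rewrite addrC addKr scalerA mulVf ?gt_eqF// scale1r.
Qed.

(** Fubini's theorem moves the integral over [xi] inside, where [waveM] turns it
    into transforms of the Gaussian at [x + y] and [x - y]; these are the kernels
    of [gauss_mean]. *)
Lemma cosT_regularized theta eta (e : R) u y : 0 < e -> rapid u -> rapid (cosT theta u) ->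
  integralRn (fun xi => cosT theta u xi * wave eta y xi * gauss (e *: xi)) =
  2^-1 * (cos (theta + eta) * gauss_mean e u (- y) + cos (theta - eta) * gauss_mean e u y).
Proof.
move=> e0 uS TS; have gS := rapid_gauss_scale e0.
have cg := rapid_continuous gS; have cu := rapid_continuous uS.
have en0 : e ^+ n != 0 by rewrite expf_neq0// gt_eqF.
pose F x xi := u x * wave theta xi x * (wave eta y xi * gauss (e *: xi)).
have -> : integralRn (fun xi => cosT theta u xi * wave eta y xi * gauss (e *: xi)) =
          integralRn (fun xi => integralRn (F ^~ xi)).
  apply: eq_integralRn => xi; rewrite -mulrA mulrC -integralRnZ; last exact/rapid_integrable/rapid_wave.
  by apply: eq_integralRn => x; rewrite mulrC.
rewrite -(@integralRn_fubini F (fun x => `|u x|) (fun xi => gauss (e *: xi))); last 4 first.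
- have mfst := @measurable_fst _ _ (n.-tuple mR) (n.-tuple mR).
  have msnd := @measurable_snd _ _ (n.-tuple mR) (n.-tuple mR).
  apply: measurable_funM; first apply: measurable_funM.
  + exact: (measurableT_comp (measurable_continuous_row cu) mfst).
  + rewrite /wave; apply: (measurableT_comp (continuous_measurable_fun (@continuous_cos R))).
    apply: measurable_funD => //; apply: measurable_funM => //.
    apply: measurable_sum => i; apply: measurable_funM.
      exact: (measurableT_comp (measurable_continuous_row (@continuous_coord R n i)) mfst).
    exact: (measurableT_comp (measurable_continuous_row (@continuous_coord R n i)) msnd).
  + have cw : continuous (fun xi => wave eta y xi * gauss (e *: xi)).
      by apply: continuous_mulf => //; exact: continuous_wave.
    exact: (measurableT_comp (measurable_continuous_row cw) msnd).
- exact: (@integrable_norm _ _ _ _ _ (u \o rot) (rapid_integrable uS)).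
- exact: rapid_integrable.
- move=> x xi; rewrite /F !normrM [`|gauss _|]ger0_norm ?expR_ge0//.
  rewrite -mulrA ler_wpM2l//.
  rewrite mulrA -[leRHS]mul1r ler_wpM2r ?expR_ge0//.
  by rewrite mulr_ile1// wave_le1.
have inner x : integralRn (F x) = (2 * e ^+ n)^-1 *
   (cos (theta + eta) * (u x * gauss (e^-1 *: (x - - y))) +
    cos (theta - eta) * (u x * gauss (e^-1 *: (x - y)))).
  have -> : integralRn (F x) = u x * 2^-1 *
      (cosT (theta + eta) (fun x => gauss (e *: x)) (x + y) +
       cosT (theta - eta) (fun x => gauss (e *: x)) (x - y)).
    rewrite -integralRnD; try exact/rapid_integrable/rapid_wave.
    rewrite -integralRnZ; last by apply: integrableRnD; exact/rapid_integrable/rapid_wave.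
    apply: eq_integralRn => xi.
    by rewrite -mulrDr mulrCA -(mulrA (u x)) -waveM /F; ring.
  have E th z := cosT_gauss_scale th z e0.
  have E' th z : cosT th (fun x => gauss (e *: x)) z = (e ^+ n)^-1 * (cos th * gauss (e^-1 *: z)).
    by rewrite -E mulKf.
  by rewrite !E' opprK invfM; ring.
rewrite (eq_integralRn inner).
have iK z : integrableRn (fun x => u x * gauss (e^-1 *: (x - z))).
  apply: rapid_integrable; apply: (rapid_mul_bounded (M := 1)) => //.
    rewrite (_ : (fun _ => _) = fun x => gauss (- e^-1 *: z + e^-1 *: x)).
      by apply: continuous_affine; exact: continuous_gauss.
    by apply/funext => x; rewrite scalerBr scaleNr addrC.
  by move=> x; rewrite ger0_norm ?expR_ge0// gauss_le1.
rewrite integralRnZ; last by apply: integrableRnD; exact: integrableRnZ.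
rewrite integralRnD; try exact: integrableRnZ.
rewrite !integralRnZ// !integralRn_gauss_kernel//.
by field; rewrite en0.
Qed.

Lemma cvg_gauss_mean (e : nat -> R) u z : e k @[k --> \oo] --> 0 -> rapid u ->
  gauss_mean (e k) u z @[k --> \oo] --> u z.
Proof.
move=> e0 uS; have cu := rapid_continuous uS.
have [C CE] : exists C, forall x, `|u x| <= C.
  have [_ /(_ [::])[C CE]] := uS; exists C => x.
  by have := CE x; rewrite /word_monomial big_nil mul1r.
have -> : u z = integralRn (fun x => u z * gauss x).
  by rewrite integralRnZ ?integralRn_gauss ?mulr1//; exact/rapid_integrable/rapid_gauss.
apply: (@integralRn_cvg _ _ (fun x => C * gauss x)).
- by move=> k; apply: continuous_mulf; [exact: continuous_affine|exact: continuous_gauss].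
- by apply: continuous_mulf; [exact: cst_continuous|exact: continuous_gauss].
- move=> x; apply: cvgMr_tmp.
  have ze : z + e k *: x @[k --> \oo] --> z.
    rewrite -[X in _ --> X]addr0 -(scale0r x).
    by apply: cvgD; [exact: cvg_cst|exact: cvgZr_tmp].
  exact: (cvg_comp _ _ ze (cu z)).
- exact/integrableRnZ/rapid_integrable/rapid_gauss.
- by move=> k x; rewrite normrM [`|gauss x|]ger0_norm ?expR_ge0// ler_wpM2r ?expR_ge0.
Qed.

(** Both sides are limits of [cosT_regularized] as the width tends to [0]. *)
Lemma cosT_inversion theta eta u y : rapid u -> rapid (cosT theta u) ->
  cosT eta (cosT theta u) y =
  2^-1 * (cos (theta + eta) * u (- y) + cos (theta - eta) * u y).
Proof.
move=> uS TS; pose e : nat -> R := harmonic.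
have e0 k : 0 < e k by rewrite invr_gt0.
have e_0 : e k @[k --> \oo] --> 0 by exact: cvg_harmonic.
have cT := rapid_continuous TS.
have lim1 : integralRn (fun xi => cosT theta u xi * wave eta y xi * gauss (e k *: xi))
    @[k --> \oo] --> cosT eta (cosT theta u) y.
  apply: (@integralRn_cvg _ _ (fun xi => `|cosT theta u xi|)).
  - move=> k; apply: continuous_mulf; last exact: (rapid_continuous (rapid_gauss_scale (e0 k))).
    by apply: continuous_mulf => //; exact: continuous_wave.
  - by apply: continuous_mulf => //; exact: continuous_wave.
  - move=> x; rewrite -[X in _ --> X]mulr1; apply: cvgMl_tmp.
    have ex : e k *: x @[k --> \oo] --> (0 : Rn) by rewrite -(scale0r x); exact: cvgZr_tmp.
    rewrite -gauss0; exact: (cvg_comp _ _ ex (@continuous_gauss R n 0)).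
  - exact: (@integrable_norm _ _ _ _ _ (cosT theta u \o rot) (rapid_integrable TS)).
  - move=> k x; rewrite normrM normrM -mulrA ler_piMr//.
    by rewrite mulr_ile1// ?wave_le1// ger0_norm ?expR_ge0// gauss_le1.
have lim2 : integralRn (fun xi => cosT theta u xi * wave eta y xi * gauss (e k *: xi))
    @[k --> \oo] --> 2^-1 * (cos (theta + eta) * u (- y) + cos (theta - eta) * u y).
  under eq_fun do rewrite cosT_regularized//.
  by apply: cvgMl_tmp; apply: cvgD; apply: cvgMl_tmp; exact: cvg_gauss_mean.
exact: (cvg_unique _ lim1 lim2).
Qed.

End inversion.

(** * The Fourier transform on Gelfand-Shilov spaces *)

Section gelfand_shilov_fourier.
Context {R : realType} {n : nat} (sigma : R) (sigma1 : 1 < sigma).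
Local Notation Rn := 'rV[R]_n.
Local Notation Re := (@complex.Re R).
Local Notation Im := (@complex.Im R).
Local Notation F := (@fourier R n).
Implicit Types (g h : Rn -> R) (f : Rn -> R[i]) (x xi y : Rn) (tau c : R).

Lemma normc_realM (m p q : R) :
  ComplexField.Normc.normc (m%:C%C * (p +i* q)%C) = Num.sqrt ((m * p) ^+ 2 + (m * q) ^+ 2).
Proof. by rewrite /= !mul0r subr0 addr0. Qed.

Lemma normc_ge_re (m p q : R) :
  `|m * p| <= ComplexField.Normc.normc (m%:C%C * (p +i* q)%C).
Proof. by rewrite normc_realM -sqrtr_sqr ler_wsqrtr// lerDl sqr_ge0. Qed.

Lemma normc_ge_im (m p q : R) :
  `|m * q| <= ComplexField.Normc.normc (m%:C%C * (p +i* q)%C).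
Proof. by rewrite normc_realM -sqrtr_sqr ler_wsqrtr// lerDr sqr_ge0. Qed.

Lemma normc_le_reDim (m p q : R) :
  ComplexField.Normc.normc (m%:C%C * (p +i* q)%C) <= `|m * p| + `|m * q|.
Proof.
rewrite normc_realM -[leRHS]ger0_norm ?addr_ge0// -sqrtr_sqr ler_wsqrtr//.
rewrite sqrrD !real_normK ?num_real// lerD2r lerDl.
by rewrite mulrn_wge0// mulr_ge0.
Qed.

Lemma GS_estimateP tau c f : GS_estimate tau sigma c f <-> forall a b x,
  ComplexField.Normc.normc ((monomial a x)%:C%C * cmpartial b f x) <=
  c * Mseq tau sigma (mindex_size a) * Mseq tau sigma (mindex_size b).
Proof.
split=> H a b.
  move=> x; rewrite -lee_fin; apply: le_trans (H a b).
  by apply: ereal_sup_ubound; exists x.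
by apply: ge_ereal_sup => _ [x _ <-]; rewrite lee_fin.
Qed.

Lemma word_partial_sorted (w : seq 'I_n) g : sorted (@leqI n) w ->
  word_partial w g = mpartial (counts w) g.
Proof. by move=> sw; rewrite [in LHS](sorted_wordE sw) word_partial_word_of. Qed.

Lemma word_monomialE (v : seq 'I_n) x : word_monomial v x = monomial (counts v) x.
Proof. by rewrite (word_monomial_perm x (word_of_counts v)) word_monomial_word_of. Qed.

Lemma mindex_size_counts (v : seq 'I_n) : mindex_size (counts v) = size v.
Proof. by rewrite -size_word_of (perm_size (word_of_counts v)). Qed.

Lemma GS_estimate_controlled tau c f : GS_estimate tau sigma c f ->
  controlled sigma tau c (Re \o f) /\ controlled sigma tau c (Im \o f).
Proof.
move=> /GS_estimateP fE; split=> v w sw x; have := fE (counts v) (counts w) x;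
  rewrite !mindex_size_counts word_monomialE word_partial_sorted//; apply: le_trans.
  exact: normc_ge_re.
exact: normc_ge_im.
Qed.

Lemma controlled_GS_estimate tau c c' f :
  controlled sigma tau c (Re \o f) -> controlled sigma tau c' (Im \o f) ->
  GS_estimate tau sigma (c + c') f.
Proof.
move=> reC imC; apply/GS_estimateP => a b x.
apply: (le_trans (normc_le_reDim _ _ _)).
have := reC (word_of a) (word_of b) (sorted_word_of b) x.
have := imC (word_of a) (word_of b) (sorted_word_of b) x.
rewrite !word_monomial_word_of !word_partial_word_of !size_word_of.
by move=> imE reE; rewrite !mulrDl lerD.
Qed.

Lemma controlledD tau c c' g h : smoothR g -> smoothR h ->
  controlled sigma tau c g -> controlled sigma tau c' h ->
  controlled sigma tau (c + c') (fun x => g x + h x).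
Proof.
move=> gC hC gc hc v w sw x.
have -> : (fun x => g x + h x) = fun x => 1 * g x + h x.
  by apply/funext => z; rewrite mul1r.
rewrite word_partial_comb// mul1r mulrDr !mulrDl.
by rewrite (le_trans (ler_normD _ _))// lerD ?gc ?hc.
Qed.

Lemma re_fourier f : rapid (Re \o f) -> rapid (Im \o f) -> Re \o F f =
  fun xi => cosT 0 (Re \o f) xi + cosT (- (pi / 2)) (Im \o f) xi.
Proof.
move=> reS imS; apply/funext => xi /=.
rewrite /cosT -integralRnD; try exact/rapid_integrable/rapid_wave.
apply: eq_integralRn => x /=; rewrite /wave addr0 cosBpihalf.
by case: (f x) => a b /=; rewrite cosN sinN mulrN opprK.
Qed.

Lemma im_fourier f : rapid (Re \o f) -> rapid (Im \o f) -> Im \o F f =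
  fun xi => cosT 0 (Im \o f) xi + cosT (pi / 2) (Re \o f) xi.
Proof.
move=> reS imS; apply/funext => xi /=.
rewrite /cosT -integralRnD; try exact/rapid_integrable/rapid_wave.
apply: eq_integralRn => x /=; rewrite /wave addr0 cosDpihalf.
by case: (f x) => a b /=; rewrite cosN sinN addrC.
Qed.

Lemma smooth_re f : smooth f -> smoothR (Re \o f).
Proof. by move=> fC k; case: (fC k). Qed.

Lemma smooth_im f : smooth f -> smoothR (Im \o f).
Proof. by move=> fC k; case: (fC k). Qed.

Lemma smoothR_cosT theta g : rapid g -> smoothR (cosT theta g).
Proof. by move=> gS k; exact: is_Ck_cosT. Qed.

Section one_function.
Variables (tau c : R) (f : Rn -> R[i]).
Hypotheses (tau0 : 0 < tau) (fC : smooth f) (fE : GS_estimate tau sigma c f).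

Let reC := smooth_re fC.
Let imC := smooth_im fC.
Let rec := (GS_estimate_controlled fE).1.
Let imc := (GS_estimate_controlled fE).2.
Let reS : rapid (Re \o f) := controlled_rapid0 sigma1 (ltW tau0) reC rec.
Let imS : rapid (Im \o f) := controlled_rapid0 sigma1 (ltW tau0) imC imc.

Lemma smooth_fourier : smooth (F f).
Proof.
by move=> k; rewrite re_fourier// im_fourier//; split; apply: is_CkD; exact: is_Ck_cosT.
Qed.

Lemma GS_estimate_fourier :
  exists2 C, 0 < C & GS_estimate (Mloss sigma * tau) sigma C (F f).
Proof.
have [C C0 CE] := controlled_cosT sigma1 tau0 reC rec.
have [D D0 DE] := controlled_cosT sigma1 tau0 imC imc.
exists ((C + D) + (D + C)); first by rewrite !addr_gt0.
apply: controlled_GS_estimate.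
  by rewrite re_fourier//; apply: controlledD; try exact: smoothR_cosT.
by rewrite im_fourier//; apply: controlledD; try exact: smoothR_cosT.
Qed.

Let rapid_cosT theta g c' : smoothR g -> controlled sigma tau c' g ->
  rapid (cosT theta g).
Proof.
move=> gC gc; have gS := controlled_rapid0 sigma1 (ltW tau0) gC gc.
have [C _ CE] := controlled_cosT sigma1 tau0 gC gc.
have tauK : 0 <= Mloss sigma * tau by rewrite mulr_ge0 ?ltW// Mloss_gt0.
exact: (controlled_rapid0 sigma1 tauK (smoothR_cosT theta gS) (CE theta)).
Qed.

(** Of the four terms in the real (imaginary) part of the double transform,
    the mixed ones vanish and in the other two the values at [y] cancel. *)
Lemma fourierK y : F (F f) y = f (- y).
Proof.
have reT theta : rapid (cosT theta (Re \o f)) := rapid_cosT theta reC rec.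
have imT theta : rapid (cosT theta (Im \o f)) := rapid_cosT theta imC imc.
have reF : rapid (Re \o F f) by rewrite re_fourier//; exact: rapidD.
have imF : rapid (Im \o F f) by rewrite im_fourier//; exact: rapidD.
have reE : Re (F (F f) y) = Re (f (- y)).
  rewrite -[LHS]/((Re \o F (F f)) y) re_fourier// (re_fourier reS imS) (im_fourier reS imS).
  rewrite !cosTD// !cosT_inversion//=.
  rewrite !(add0r, subr0, addr0, subrr, opprK, addNr) -splitr !cosN cos_pihalf cos0 cospi.
  by field.
have imE : Im (F (F f) y) = Im (f (- y)).
  rewrite -[LHS]/((Im \o F (F f)) y) im_fourier// (re_fourier reS imS) (im_fourier reS imS).
  rewrite !cosTD// !cosT_inversion//=.
  rewrite !(add0r, subr0, addr0, subrr, opprK, addNr) -opprD -splitr !cosN cos_pihalf cos0 cospi.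
  by field.
by case: (F (F f) y) (f (- y)) reE imE => [a b] [a' b'] /= -> ->.
Qed.

End one_function.

Lemma fourier_roumieu f : GS_roumieu n sigma f -> GS_roumieu n sigma (F f).
Proof.
move=> [fC [tau tau0 [c c0 fE]]]; split; first exact: smooth_fourier fE.
exists (Mloss sigma * tau); first by rewrite mulr_gt0// Mloss_gt0.
exact: GS_estimate_fourier.
Qed.

Lemma fourier_beurling f : GS_beurling n sigma f -> GS_beurling n sigma (F f).
Proof.
move=> [fC fE]; split.
  by have [c _] := fE 1 ltr01; exact: smooth_fourier.
move=> tau tau0; have K0 := Mloss_gt0 sigma.
have tauK : 0 < tau / Mloss sigma by rewrite divr_gt0.
have [c c0 fEc] := fE _ tauK.
have := GS_estimate_fourier tauK fC fEc.
by rewrite mulrC divfK// gt_eqF.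
Qed.

Lemma fourierK_roumieu f : GS_roumieu n sigma f -> F (F f) = f \o -%R.
Proof. by move=> [fC [tau tau0 [c c0 fE]]]; apply/funext => y; exact: fourierK fE y. Qed.

Lemma fourierK_beurling f : GS_beurling n sigma f -> F (F f) = f \o -%R.
Proof.
move=> [fC fE]; have [c c0 fE1] := fE 1 ltr01.
by apply/funext => y; exact: (fourierK ltr01 fC fE1).
Qed.

(** The fourth power of the transform is the identity on [S]. *)
Lemma fourier_image (S : set (Rn -> R[i])) : (forall f, S f -> S (F f)) ->
  (forall f, S f -> F (F f) = f \o -%R) -> F @` S = S.
Proof.
move=> SF SFF; apply/seteqP; split=> [_ [f Sf <-]|f Sf]; first exact: SF.
exists (F (F (F f))); first exact: SF (SF _ (SF _ Sf)).
rewrite SFF; last exact: SF (SF _ Sf).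
by rewrite SFF//; apply/funext => y /=; rewrite opprK.
Qed.

End gelfand_shilov_fourier.

Theorem theorem4p1 (R : realType) (n : nat) (sigma : R) :
  (0 < n)%N -> 1 < sigma ->
  fourier (n := n) @` GS_roumieu n sigma = GS_roumieu n sigma /\
  fourier (n := n) @` GS_beurling n sigma = GS_beurling n sigma.
Proof.
move=> _ sigma1; split; apply: fourier_image.
- exact: fourier_roumieu.
- exact: fourierK_roumieu.
- exact: fourier_beurling.
- exact: fourierK_beurling.
Qed.
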